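(* Let $\mathfrak{X}$ be an abstract state space, $(\mathcal{U}(t))_{t\ge0}$ a substochastic $C_0$-semigroup on $\mathfrak{X}$ with generator $\mathcal{A}$, $\mathcal{B}:\mathscr{D}(\mathcal{A})\to\mathfrak{X}$ a positive linear operator with $\langle\mathbf{\Psi},(\mathcal{A}+\mathcal{B})u\rangle\le0$ for all $u\in\mathscr{D}(\mathcal{A})\cap\mathfrak{X}_+$, and let $\mathcal{G}$ be the generator of the associated minimal semigroup. Then $\mathcal{G}=\overline{\mathcal{A}+\mathcal{B}}$ if and only if $\mathbf{\Xi}_\lambda=0$ for some (or equivalently for all) $\lambda>0$.
   Context: An abstract state space is a real ordered Banach space $\mathfrak{X}$ whose positive cone $\mathfrak{X}_+$ is closed, generating ($\mathfrak{X}=\mathfrak{X}_+-\mathfrak{X}_+$), and on which the norm is additive: $\|u+v\|=\|u\|+\|v\|$ for $u,v\in\mathfrak{X}_+$. $\mathbf{\Psi}\in\mathfrak{X}^\star_+$ is the positive functional with $\langle\mathbf{\Psi},u\rangle=\|u\|$ for $u\in\mathfrak{X}_+$. A linear operator is positive if it maps positive elements of its domain into $\mathfrak{X}_+$. A $C_0$-semigroup $(T(t))_{t\ge0}$ is substochastic if each $T(t)$ is positive and $\|T(t)u\|\le\|u\|$ for $u\in\mathfrak{X}_+$. Minimal semigroup: under the stated hypotheses there is a smallest (for the operator order, for each $t$) substochastic $C_0$-semigroup $(\mathcal{V}(t))_{t\ge0}$ whose generator $\mathcal{G}$ extends $(\mathcal{A}+\mathcal{B},\mathscr{D}(\mathcal{A}))$;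 it satisfies $(\lambda-\mathcal{G})^{-1}u=\lim_{n\to\infty}(\lambda-\mathcal{A})^{-1}\sum_{k=0}^n[\mathcal{B}(\lambda-\mathcal{A})^{-1}]^ku$ for all $\lambda>0$, $u\in\mathfrak{X}$. $\overline{\mathcal{A}+\mathcal{B}}$ is the closure of $(\mathcal{A}+\mathcal{B},\mathscr{D}(\mathcal{A}))$. Functionals: $\mathfrak{a}_0(u)=-\langle\mathbf{\Psi},\mathcal{G}u\rangle$ for $u\in\mathscr{D}(\mathcal{G})$; $\mathfrak{a}$ is its restriction to $\mathscr{D}(\mathcal{A})$, i.e. $\mathfrak{a}(u)=-\langle\mathbf{\Psi},\mathcal{A}u+\mathcal{B}u\rangle$; and $\overline{\mathfrak{a}}:\mathscr{D}(\mathcal{G})\to\mathbb{R}$ is the linear functional defined by $\overline{\mathfrak{a}}((\lambda-\mathcal{G})^{-1}u)=\sum_{n=0}^\infty\mathfrak{a}\big((\lambda-\mathcal{A})^{-1}[\mathcal{B}(\lambda-\mathcal{A})^{-1}]^nu\big)$, $u\in\mathfrak{X}$, where the series converges and the resulting functional does not depend on $\lambda>0$. For $\lambda>0$, $\mathbf{\Xi}_\lambda\in\mathfrak{X}^\star$ is defined by $\langle\mathbf{\Xi}_\lambda,u\rangle=\mathfrak{a}_0((\lambda-\mathcal{G})^{-1}u)-\overline{\mathfrak{a}}((\lambda-\mathcal{G})^{-1}u)$, $u\in\mathfrak{X}$. *)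

(* Defs.v *)
From HB Require Import structures.
From mathcomp Require Import all_boot all_order all_algebra.
From mathcomp Require Import all_classical all_reals all_analysis.

Set Implicit Arguments.
Unset Strict Implicit.
Unset Printing Implicit Defensive.

Import Order.TTheory GRing.Theory Num.Theory.
Import numFieldNormedType.Exports.

Local Open Scope classical_set_scope.
Local Open Scope ring_scope.

Section Defs.
Context {R : realType} {X : completeNormedModType R}.

(* The order of the space is given by its positive cone: u <= v means
   cone (v - u). *)
Record abstract_state_space (cone : set X) : Prop := {
  cone0 : cone 0 ;
  coneD : forall u v, cone u -> cone v -> cone (u + v) ;
  coneZ : forall (c : R) u, 0 <= c -> cone u -> cone (c *: u) ;
  cone_pointed : forall u, cone u -> cone (- u) -> u = 0 ;
  cone_closed : closed cone ;
  cone_generating : forall u, exists v w, [/\ cone v, cone w & u = v - w] ;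
  cone_normD : forall u v, cone u -> cone v -> `|u + v| = `|u| + `|v| }.

(* As the cone is generating, the last clause determines Psi; positivity of Psi
   is a consequence of it. *)
Definition norm_functional (cone : set X) (Psi : X -> R) : Prop :=
  [/\ scalar Psi, continuous Psi & forall u, cone u -> Psi u = `|u|].

(* An unbounded operator: the values of [act] off [dom] are irrelevant. *)
Record operator := Operator { dom : set X ; act :> X -> X }.

Definition graph (A : operator) : set (X * X) :=
  [set p | dom A p.1 /\ p.2 = A p.1].

(* A + B on the domain of A; only the values of B on that domain matter. *)
Definition perturbed (A : operator) (B : X -> X) : operator :=
  Operator (dom A) (fun u => A u + B u).

Definition linear_on (D : set X) (B : X -> X) : Prop :=
  forall (c : R) u v, D u -> D v -> B (c *: u + v) = c *: B u + B v.

Definition positive_on (cone D : set X) (B : X -> X) : Prop :=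
  forall u, D u -> cone u -> cone (B u).

(* (lambda - A)^-1; the set below is a singleton when lambda lies in the
   resolvent set of A. *)
Definition resolvent (A : operator) (lambda : R) (u : X) : X :=
  xget 0 [set v | dom A v /\ lambda *: v - A v = u].

(* Semigroups are indexed by R, but only the times t >= 0 matter. *)
Record C0_semigroup (T : R -> X -> X) : Prop := {
  semigroup_linear : forall t, 0 <= t -> linear (T t) ;
  semigroup_continuous : forall t, 0 <= t -> continuous (T t) ;
  semigroup0 : forall u, T 0 u = u ;
  semigroupD : forall s t, 0 <= s -> 0 <= t ->
    forall u, T (s + t) u = T s (T t u) ;
  semigroup_strong : forall u, T t u @[t --> 0^'+] --> u }.

Definition diff_quotient (T : R -> X -> X) (u : X) (h : R) : X :=
  h^-1 *: (T h u - u).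

Definition generator (T : R -> X -> X) : operator :=
  Operator [set u | cvg (diff_quotient T u h @[h --> 0^'+])]
           (fun u => lim (diff_quotient T u h @[h --> 0^'+])).

Definition substochastic (cone : set X) (T : R -> X -> X) : Prop :=
  [/\ C0_semigroup T,
      forall t u, 0 <= t -> cone u -> cone (T t u)
    & forall t u, 0 <= t -> cone u -> `|T t u| <= `|u|].

Definition substochastic_extension (cone : set X) (C : operator)
    (T : R -> X -> X) : Prop :=
  substochastic cone T /\ graph C `<=` graph (generator T).

Definition minimal_semigroup (cone : set X) (C : operator)
    (V : R -> X -> X) : Prop :=
  substochastic_extension cone C V /\
  forall W, substochastic_extension cone C W ->
    forall t u, 0 <= t -> cone u -> cone (W t u - V t u).

Section Functionals.
Variables (Psi : X -> R) (A : operator) (B : X -> X) (G : operator).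

Definition a_fun (u : X) : R := - Psi (A u + B u).

Definition a0_fun (u : X) : R := - Psi (G u).

Definition abar_term (lambda : R) (u : X) (n : nat) : R :=
  a_fun (resolvent A lambda
    (iter n (fun w => B (resolvent A lambda w)) u)).

(* For v in the domain of G, the common value of the sums of the series
   associated with all pairs (lambda, u) such that v = (lambda - G)^-1 u. *)
Definition abar_fun (v : X) : R :=
  xget 0 [set r | forall lambda u, 0 < lambda -> resolvent G lambda u = v ->
                    series (abar_term lambda u) @ \oo --> r].

Definition Xi (lambda : R) (u : X) : R :=
  a0_fun (resolvent G lambda u) - abar_fun (resolvent G lambda u).

End Functionals.
End Defs.

Arguments operator {R} X.

(* Main.v *)
(* Write R = (lambda - A)^-1 and J = B R.  On the cone J is a contraction, so
   L_lambda u := lim Psi (J^n u) exists, and summing the series defining abar gives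
   Xi_lambda u = L_lambda u, provided that (lambda - G)^-1 u is the limit F u of
   v_n = R (u + J u + ... + J^(n-1) u) and that abar does not depend on lambda.

   F is the resolvent of a substochastic semigroup whose generator extends A + B,
   so minimality of V forces (lambda - G)^-1 <= F, and v_n <= (lambda - G)^-1 u
   gives the converse.  Independence of lambda comes from comparing the iterations
   for two parameters.

   Since (lambda - A - B) v_n = u - J^n u, if L_lambda vanishes then v_n converges
   to F u in the graph norm.  Conversely L_lambda is bounded and vanishes on the
   range of lambda - A - B, which is dense when G is the closure of A + B. *)

Require Import Defs.
From HB Require Import structures.
From mathcomp Require Import all_boot all_order all_algebra.
From mathcomp Require Import all_classical all_reals all_analysis.
From mathcomp Require Import ring lra.

Set Implicit Arguments.
Unset Strict Implicit.
Unset Printing Implicit Defensive.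

Import Order.TTheory GRing.Theory Num.Theory.
Import numFieldNormedType.Exports.

Local Open Scope classical_set_scope.
Local Open Scope ring_scope.

(** * Deciding identities in modules by comparing coefficients *)

(** The operators at hand are positive and contract the norm on the cone only. On all vectors they
    contract the decomposition norm [dnorm], which a Baire argument shows equivalent to the norm;
    estimates for vectors without sign are made in it, and continuity of positive operators and
    extension of limits from dense sets follow from it.

    Minimality compares [V] with semigroups, whereas F is only a family of operators, so a semigroup
    has to be built from F. Implicit Euler steps do this; they need the resolvent identity for F,
    which is obtained from the order: the iterations for two parameters bound each other, one of
    them with a shift in the number of steps. The same comparison of iterations, seen through [Psi],
    makes L independent of the parameter.

    Integrals of orbits appear only through their Riemann sums: order, semigroup law and generator
    can all be tested on these sums before passing to the limit. *)

Inductive lexp (K : Type) :=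
  | LVar of nat
  | LZero
  | LAdd of lexp K & lexp K
  | LOpp of lexp K
  | LScale of K & lexp K.
Arguments LVar {K}.
Arguments LZero {K}.

Fixpoint lexp_eval (K : pzRingType) (M : lmodType K) (env : seq M)
    (e : lexp K) : M :=
  match e with
  | LVar i => nth 0 env i
  | LZero => 0
  | LAdd e1 e2 => lexp_eval env e1 + lexp_eval env e2
  | LOpp e1 => - lexp_eval env e1
  | LScale c e1 => c *: lexp_eval env e1
  end.

(** [Nat.eqb] is used instead of [==] because [cbn] computes it on numerals. *)
Fixpoint lexp_coef (K : pzRingType) (e : lexp K) (i : nat) : K :=
  match e with
  | LVar j => if Nat.eqb j i then 1 else 0
  | LZero => 0
  | LAdd e1 e2 => lexp_coef e1 i + lexp_coef e2 i
  | LOpp e1 => - lexp_coef e1 i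
  | LScale c e1 => c * lexp_coef e1 i
  end.

(** Recursion on [n] lets [cbn] unfold this into one scalar goal per atom, left to [ring] or
    [field]. *)
Fixpoint lexp_same (K : pzRingType) (n : nat) (e1 e2 : lexp K) : Prop :=
  match n with
  | 0 => True
  | m.+1 => lexp_coef e1 m = lexp_coef e2 m /\ lexp_same m e1 e2
  end.

Lemma lexp_evalE (K : pzRingType) (M : lmodType K) (env : seq M) (e : lexp K) :
  lexp_eval env e = \sum_(i < size env) lexp_coef e i *: nth 0 env i.
Proof.
elim: e => [j||e1 IH1 e2 IH2|e IH|c e IH] /=.
- have [jn|nj] := ltnP j (size env); last first.
    rewrite nth_default// big1// => i _.
    have /PeanoNat.Nat.eqb_neq -> : (j <> i)%N by move=> ji; move: (ltn_ord i); rewrite -ji ltnNge nj.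
    by rewrite scale0r.
  rewrite (bigD1 (Ordinal jn))//= PeanoNat.Nat.eqb_refl scale1r big1 ?addr0// => i ij.
  have /PeanoNat.Nat.eqb_neq -> : (j <> i)%N by move=> ji; case/eqP: ij; apply/val_inj.
  by rewrite scale0r.
- by rewrite big1// => i _; rewrite scale0r.
- by rewrite IH1 IH2 -big_split; apply: eq_bigr => i _; rewrite scalerDl.
- by rewrite IH -sumrN; apply: eq_bigr => i _; rewrite scaleNr.
- by rewrite IH scaler_sumr; apply: eq_bigr => i _; rewrite scalerA.
Qed.

Lemma lexp_eval_eq (K : pzRingType) (M : lmodType K) (env : seq M)
    (e1 e2 : lexp K) :
  lexp_same (size env) e1 e2 -> lexp_eval env e1 = lexp_eval env e2.
Proof.
move=> same; rewrite !lexp_evalE; apply: eq_bigr => i _; congr (_ *: _).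
elim: (size env) same (nat_of_ord i) (ltn_ord i) => // n IH [/= en same] j.
by rewrite ltnS leq_eqVlt => /predU1P[->//|]; exact: IH.
Qed.

Ltac lmod_index env x :=
  lazymatch env with
  | x :: _ => constr:(0%N)
  | _ :: ?env' => let i := lmod_index env' x in constr:(i.+1)
  end.

(** [lmod_index] is run only to see whether it fails: failure makes the inner [match] fall through
    to the branch that adds the atom. *)
Ltac lmod_atoms env e :=
  lazymatch e with
  | 0%R => env
  | (?a + ?b)%R => let env' := lmod_atoms env a in lmod_atoms env' b
  | (- ?a)%R => lmod_atoms env a
  | (_ *: ?a)%R => lmod_atoms env a
  | _ => match env with
         | _ => let i := lmod_index env e in env
         | _ => constr:(e :: env)
         end
  end.

Ltac lmod_reify K env e :=
  lazymatch e with
  | 0%R => constr:(@LZero K)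
  | (?a + ?b)%R => let a' := lmod_reify K env a in
                   let b' := lmod_reify K env b in constr:(LAdd a' b')
  | (- ?a)%R => let a' := lmod_reify K env a in constr:(LOpp a')
  | (?c *: ?a)%R => let a' := lmod_reify K env a in constr:(LScale c a')
  | _ => let i := lmod_index env e in constr:(@LVar K i)
  end.

(* Solves [e1 = e2] in an [R]-module up to side conditions [_ != 0] coming from
   divisions in the scalars. *)
Ltac lmod K M :=
  match goal with
  | |- ?e1 = ?e2 =>
    let env0 := lmod_atoms (@nil M) e1 in
    let env := lmod_atoms env0 e2 in
    let r1 := lmod_reify K env e1 in
    let r2 := lmod_reify K env e2 in
    change (@lexp_eval K M env r1 = @lexp_eval K M env r2);
    apply: lexp_eval_eq; cbn [size lexp_same lexp_coef Nat.eqb];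
    repeat (split; [first [by [] | ring | field]|]); try exact: Logic.I
  end.

(** * Limits in normed modules *)

Section Limits.
Context {R : realType} {X : normedModType R}.
Implicit Types (u : nat -> X) (l : X).

Lemma cvgn_distP u l :
  u @ \oo --> l <->
  forall e : R, 0 < e -> exists N, forall n, (N <= n)%N -> `|u n - l| <= e.
Proof.
split=> [/cvgrPdistC_le ul e e0|ul].
  by have [N _ uN] := ul e e0; exists N => n Nn; exact: uN.
apply/cvgrPdistC_le => e e0; have [N uN] := ul e e0.
by exists N => // n /= Nn; exact: uN.
Qed.

Lemma cvg_at_right0P (f : R -> X) l :
  f h @[h --> 0^'+] --> l <->
  forall e : R, 0 < e ->
    exists2 d, 0 < d & forall h, 0 < h -> h < d -> `|f h - l| <= e.
Proof.
split=> [/cvgrPdistC_le fl e e0|fl].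
  have [d /= d0 fd] := fl e e0; exists d => // h h0 hd.
  by apply: fd => //=; rewrite sub0r normrN gtr0_norm.
apply/cvgrPdistC_le => e e0; have [d d0 fd] := fl e e0.
exists d => //= h /=; rewrite sub0r normrN => hd h0.
by apply: fd => //; rewrite -(gtr0_norm h0).
Qed.

Lemma geometric_small (C q e : R) : 0 <= q -> q < 1 -> 0 < e ->
  exists N, forall n, (N <= n)%N -> C * q ^+ n <= e.
Proof.
move=> q0 q1 e0.
have : (fun n => C * q ^+ n) @ \oo --> (C * 0 : R).
  by apply: cvgMr; apply: cvg_expr; rewrite ger0_norm.
move=> /cvgrPdist_le/(_ e e0)[N _ qN]; exists N => n /qN.
by rewrite mulr0 sub0r normrN; apply: le_trans; exact: ler_norm.
Qed.

Lemma cvgn_dist_le u l (C : R) : u @ \oo --> l ->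
  (exists N, forall n, (N <= n)%N -> `|u n| <= C) -> `|l| <= C.
Proof.
move=> ul [N uN]; apply/ler_addgt0Pr => e e0.
have [M uM] := (cvgn_distP u l).1 ul e e0.
have h1 := uN _ (leq_maxl N M); have h2 := uM _ (leq_maxr N M).
have -> : l = u (maxn N M) - (u (maxn N M) - l) by lmod R X.
by rewrite (le_trans (ler_normB _ _))// lerD.
Qed.

End Limits.

Section CompleteLimits.
Context {R : realType} {X : completeNormedModType R}.
Implicit Types (u : nat -> X).

Lemma cauchy_dist_cvgn u :
  (forall e : R, 0 < e -> exists N, forall n m, (N <= n)%N -> (n <= m)%N ->
     `|u n - u m| <= e) ->
  exists l : X, u @ \oo --> l.
Proof.
move=> cu; suff : cvgn u by exists (limn u).
apply/cauchy_cvgP; apply: cauchy_exP => e e0.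
have [N uN] := cu (e / 2) ltac:(lra).
exists (u N); exists N => // n /= Nn.
rewrite -ball_normE /=; apply: (@le_lt_trans _ _ (e / 2)); last lra.
exact: uN.
Qed.

Lemma cvgn_geometric_steps u (C q : R) : 0 <= q -> q < 1 ->
  (forall k, `|u k.+1 - u k| <= C * q ^+ k) -> exists l : X, u @ \oo --> l.
Proof.
move=> q0 q1 uC; apply: cauchy_dist_cvgn => e e0.
pose D := C / (1 - q).
have C0 : 0 <= C by have := uC 0%N; rewrite expr0 mulr1; apply: le_trans.
have D0 : 0 <= D by rewrite divr_ge0// subr_ge0 ltW.
(* [D] is the sum of the geometric series, so [C * q ^+ k] is the decrease of [D * q ^+ k]; keeping
   the subtracted tail closes the induction. *)
have uD n k : `|u n - u (n + k)%N| <= D * q ^+ n - D * q ^+ (n + k).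
  elim: k => [|k IH]; first by rewrite addn0 !subrr normr0.
  have -> : u n - u (n + k.+1)%N =
      (u n - u (n + k)%N) - (u (n + k).+1 - u (n + k)%N).
    by rewrite addnS; lmod R X.
  apply: (le_trans (ler_normB _ _)); apply: (le_trans (lerD IH (uC _))).
  rewrite addnS exprS.
  have -> : C * q ^+ (n + k) = D * q ^+ (n + k) - D * (q * q ^+ (n + k)).
    by rewrite /D; field; rewrite subr_eq0 gt_eqF.
  lra.
have [N N2] := geometric_small D q0 q1 e0.
exists N => n m Nn nm; rewrite -(subnKC nm).
apply: (le_trans (uD _ _)); apply: le_trans (N2 n Nn).
by rewrite lerBlDr lerDl mulr_ge0// exprn_ge0.
Qed.

End CompleteLimits.

Lemma sum_nat_recr {V : zmodType} n (g : nat -> V) :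
  \sum_(0 <= k < n.+1) g k = \sum_(0 <= k < n) g k + g n.
Proof. by rewrite big_nat_recr. Qed.

(** * Linear maps between normed modules *)

Section LinearMaps.
Context {R : realType} {X Y : normedModType R}.
Variable f : X -> Y.
Hypothesis flin : linear f.

Lemma linear_D u v : f (u + v) = f u + f v.
Proof. by have := flin 1 u v; rewrite !scale1r. Qed.

Lemma linear_0 : f 0 = 0.
Proof. by have := linear_D 0 0; rewrite addr0 => /eqP; rewrite addrC -subr_eq subrr eq_sym => /eqP. Qed.

Lemma linear_Z c u : f (c *: u) = c *: f u.
Proof. by have := flin c u 0; rewrite !addr0 linear_0 addr0. Qed.

Lemma linear_N u : f (- u) = - f u.
Proof. by rewrite -scaleN1r linear_Z scaleN1r. Qed.

Lemma linear_B u v : f (u - v) = f u - f v.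
Proof. by rewrite linear_D linear_N. Qed.

Lemma linear_sum n (g : nat -> X) :
  f (\sum_(0 <= k < n) g k) = \sum_(0 <= k < n) f (g k).
Proof.
elim: n => [|n IH]; first by rewrite !big_geq// linear_0.
by rewrite !sum_nat_recr linear_D IH.
Qed.

Lemma linear_bounded_continuous (M : R) :
  (forall u, `|f u| <= M * `|u|) -> continuous f.
Proof.
move=> fM x; apply/cvgrPdist_le => e e0.
have M0 : 0 < `|M| + 1 by rewrite ltr_wpDl.
near=> y; rewrite -linear_B; apply: (le_trans (fM _)).
apply: (@le_trans _ _ ((`|M| + 1) * `|x - y|)).
  by rewrite ler_wpM2r// (le_trans (ler_norm _))// lerDl.
rewrite mulrC -ler_pdivlMr//.
near: y; apply: cvgr_dist_le; [exact: cvg_id|exact: divr_gt0].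
Unshelve. all: by end_near. Qed.

End LinearMaps.

(** * The cone and the decomposition norm *)

Section Cone.
Context {R : realType} {X : completeNormedModType R}.
Variable cone : set X.
Hypothesis hX : abstract_state_space cone.

Lemma cone_lim (u : nat -> X) (l : X) :
  (forall n, cone (u n)) -> u @ \oo --> l -> cone l.
Proof.
move=> cu ul; have cc := cone_closed hX.
by apply: (@closed_cvg _ _ _ _ u cone cc _ l ul); exact: nearW.
Qed.

Lemma cone_sum n (g : nat -> X) :
  (forall k, cone (g k)) -> cone (\sum_(0 <= k < n) g k).
Proof.
move=> cg; elim: n => [|n IH]; first by rewrite big_geq//; exact: cone0 hX.
by rewrite sum_nat_recr; exact: (coneD hX).
Qed.

Lemma cone_trans (v u w : X) : cone (v - u) -> cone (w - v) -> cone (w - u).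
Proof.
move=> vu wv; have -> : w - u = (w - v) + (v - u) by lmod R X.
exact: (coneD hX).
Qed.

Lemma cone_antisym (u v : X) : cone (v - u) -> cone (u - v) -> u = v.
Proof.
by move=> vu uv; apply/eqP; rewrite -subr_eq0; apply/eqP;
  apply: (cone_pointed hX) => //; rewrite opprB.
Qed.

Lemma cone_norm_le (u v : X) : cone u -> cone (v - u) -> `|u| <= `|v|.
Proof.
by move=> cu cvu; have := cone_normD hX cvu cu; rewrite subrK => ->; rewrite lerDr.
Qed.

Lemma cone_normB (u v : X) : cone u -> cone (v - u) -> `|v - u| = `|v| - `|u|.
Proof.
by move=> cu cvu; have := cone_normD hX cvu cu; rewrite subrK => ->; rewrite addrK.
Qed.

Definition decomp_norms (u : X) : set R :=
  [set r | exists p q, [/\ cone p, cone q, u = p - q & r = `|p| + `|q|]].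

(** A positive operator that contracts the norm on the cone contracts [dnorm] everywhere, while its
    operator norm may exceed 1. *)
Definition dnorm (u : X) : R := inf (decomp_norms u).

Lemma dnorm_has_inf u : has_inf (decomp_norms u).
Proof.
split; last by exists 0 => _ [p [q [_ _ _ ->]]]; rewrite addr_ge0.
by have [p [q [cp cq uE]]] := cone_generating hX u; exists (`|p| + `|q|), p, q.
Qed.

Lemma dnorm_le p q : cone p -> cone q -> dnorm (p - q) <= `|p| + `|q|.
Proof.
by move=> cp cq; apply: ge_inf; [exact: (dnorm_has_inf _).2|exists p, q].
Qed.

Lemma dnorm_decomp u (e : R) : 0 < e ->
  exists p q, [/\ cone p, cone q, u = p - q & `|p| + `|q| < dnorm u + e].
Proof.
move=> e0; have [_ [p [q [cp cq uE ->]]] lt] := inf_adherent e0 (dnorm_has_inf u).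
by exists p, q.
Qed.

Lemma norm_le_dnorm u : `|u| <= dnorm u.
Proof.
apply: lb_le_inf; first exact: (dnorm_has_inf u).1.
by move=> _ [p [q [_ _ -> ->]]]; exact: ler_normB.
Qed.

Lemma dnorm_ge0 u : 0 <= dnorm u.
Proof. exact: le_trans (norm_le_dnorm u). Qed.

Lemma dnorm_cone u : cone u -> dnorm u = `|u|.
Proof.
move=> cu; apply/eqP; rewrite eq_le norm_le_dnorm andbT.
by have := dnorm_le cu (cone0 hX); rewrite subr0 normr0 addr0.
Qed.

Lemma dnorm0 : dnorm 0 = 0.
Proof. by rewrite dnorm_cone ?normr0//; exact: cone0 hX. Qed.

Lemma dnormD u v : dnorm (u + v) <= dnorm u + dnorm v.
Proof.
apply/ler_addgt0Pr => e e0.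
have [p [q [cp cq -> le1]]] := dnorm_decomp u (e := e / 2) ltac:(lra).
have [p' [q' [cp' cq' -> le2]]] := dnorm_decomp v (e := e / 2) ltac:(lra).
have -> : p - q + (p' - q') = (p + p') - (q + q') by lmod R X.
apply: (le_trans (dnorm_le (coneD hX cp cp') (coneD hX cq cq'))).
by rewrite !(cone_normD hX)//; move: le1 le2 => /=; lra.
Qed.

Lemma dnormN u : dnorm (- u) = dnorm u.
Proof.
suff le v : dnorm (- v) <= dnorm v.
  by apply/eqP; rewrite eq_le le/= -{1}[u]opprK le.
apply/ler_addgt0Pr => e e0; have [p [q [cp cq -> le]]] := dnorm_decomp v e0.
by rewrite opprB (le_trans (dnorm_le cq cp))// addrC ltW.
Qed.

Lemma dnormB u v : dnorm (u - v) <= dnorm u + dnorm v.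
Proof. by rewrite -(dnormN v); exact: dnormD. Qed.

Lemma dnormZ_ge0 c u : 0 <= c -> dnorm (c *: u) <= c * dnorm u.
Proof.
move=> c0; apply/ler_addgt0Pr => e e0.
(* Dividing the error by [c + 1] instead of [c] covers [c = 0]. *)
have c10 : 0 < c + 1 by lra.
have [p [q [cp cq -> lt]]] := dnorm_decomp u (divr_gt0 e0 c10).
rewrite scalerBr; apply: (le_trans (dnorm_le (coneZ hX c0 cp) (coneZ hX c0 cq))).
rewrite !normrZ ger0_norm// -mulrDr.
apply: (le_trans (ler_wpM2l c0 (ltW lt))).
rewrite mulrDr lerD2l mulrCA ger_pMr// ler_pdivrMr// mul1r; lra.
Qed.

Lemma dnorm_sum n (g : nat -> X) :
  dnorm (\sum_(0 <= k < n) g k) <= \sum_(0 <= k < n) dnorm (g k).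
Proof.
elim: n => [|n IH]; first by rewrite !big_geq// dnorm0.
by rewrite !sum_nat_recr (le_trans (dnormD _ _))// lerD2r.
Qed.

Lemma dnorm_sum_le n (g : nat -> X) (C : R) :
  (forall k, (k < n)%N -> dnorm (g k) <= C) ->
  dnorm (\sum_(0 <= k < n) g k) <= n%:R * C.
Proof.
move=> gC; apply: (le_trans (dnorm_sum _ _)).
rewrite -{2}[n]subn0 mulr_natl -sumr_const_nat.
by apply: ler_sum_nat => k /andP[_]; exact: gC.
Qed.

(* Baire: some sublevel set of [dnorm] is dense in a ball, hence, by symmetry
   and convexity, in a ball centered at the origin. *)
Lemma dnorm_approx :
  exists2 K : R, 0 < K & forall y (d : R), 0 < d -> `|y| <= d ->
    exists p q, [/\ cone p, cone q, `|y - (p - q)| <= d / 2 &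
                    `|p| + `|q| <= K * d].
Proof.
pose C (n : nat) := [set u : X | dnorm u <= n%:R].
have [n nd] : exists n, ~ dense (~` closure (C n)).
  apply/existsNP => allD.
  have /Baire dI : forall i, open (~` closure (C i)) /\ dense (~` closure (C i)).
    by move=> i; split; [exact/closed_openC/closed_closure|exact: allD].
  have [] := dI setT (ex_intro _ 0 Logic.I) openT.
  move=> u [_ /(_ (Num.truncn (dnorm u)).+1 Logic.I)]; apply.
  by apply: subset_closure; rewrite /C /= ltW// truncnS_gt.
move: nd => /denseNE [W [[x Ox] OC]].
have : nbhs x W by exact: open_nbhs_nbhs.
move=> /nbhs_ballP[r /= r0 rO].
have near_C z (e : R) : `|z| < r -> 0 < e -> exists2 a, dnorm a <= n%:R & `|x + z - a| <= e.
  move=> zr e0.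
  have /rO Wxz : ball x r (x + z).
    by rewrite -ball_normE /= opprD addrA subrr sub0r normrN.
  have /contrapT cl : ~ ~ closure (C n) (x + z).
    by move=> nc; suff : (W `&` ~` closure (C n)) (x + z) by rewrite OC.
  have [a [Ca ba]] := cl _ (nbhsx_ballx _ _ e0).
  by exists a => //; move: ba; rewrite -ball_normE => /ltW.
(* With [t = r / (2 d)] the vector [t y] stays in the ball of radius [r], so [x + t y] and [x] have
   approximants [a] and [b] in the sublevel set, and [(a - b) / t] approximates [y]. Here [n + n]
   bounds [dnorm (a - b)], 1 is the slack of its decomposition, and [2 / r] is [1 / (t d)]. *)
exists ((n%:R + n%:R + 1) * (2 / r)).
  by rewrite mulr_gt0 ?divr_gt0// ltr_wpDl// addr_ge0.
move=> y d d0 yd.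
pose t := r / (2 * d).
have t0 : 0 < t by rewrite divr_gt0// mulr_gt0.
have zr : `|t *: y| < r.
  rewrite normrZ gtr0_norm//.
  apply: (@le_lt_trans _ _ (t * d)); first by rewrite ler_pM2l.
  have -> : t * d = r / 2 by rewrite /t; field; rewrite gt_eqF.
  lra.
have e0 : 0 < t * d / 4 by have := mulr_gt0 t0 d0; lra.
have [a aC ax] := near_C _ _ zr e0.
have [b bC bx] := near_C 0 (t * d / 4) (eq_ind_r (fun s => s < r) r0 (normr0 _)) e0.
have [p [q [cp cq abE pq]]] := dnorm_decomp (a - b) (ltr01 (R := R)).
exists (t^-1 *: p), (t^-1 *: q); split.
- by apply: (coneZ hX) => //; rewrite invr_ge0 ltW.
- by apply: (coneZ hX) => //; rewrite invr_ge0 ltW.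
- rewrite -scalerBr -abE.
  have -> : y - t^-1 *: (a - b) = t^-1 *: ((x + t *: y - a) - (x + 0 - b)).
    by lmod R X; rewrite gt_eqF.
  rewrite normrZ gtr0_norm ?invr_gt0// mulrC ler_pdivrMr//.
  by rewrite (le_trans (ler_normB _ _))// (le_trans (lerD ax bx))//; lra.
- rewrite !normrZ gtr0_norm ?invr_gt0// -mulrDr.
  have -> : (n%:R + n%:R + 1) * (2 / r) * d = t^-1 * (n%:R + n%:R + 1).
    by rewrite /t; field; rewrite !gt_eqF.
  rewrite ler_pM2l ?invr_gt0// (le_trans (ltW pq))// lerD2r.
  by rewrite (le_trans (dnormB _ _))// lerD.
Qed.

(** Successive approximation as in the open mapping theorem: [dnorm_approx] is applied to the
    residual [y k], whose bound [d k] halves at each step. The positive and the negative parts form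
    convergent series with sums in the closed cone, each of norm at most [2 * K * |u|]; hence the
    factor 4. *)
Lemma dnorm_equiv : exists2 M : R, 0 < M & forall u, dnorm u <= M * `|u|.
Proof.
have [K K0 app] := dnorm_approx.
exists (4 * K); first by rewrite mulr_gt0 ?ltr0n.
move=> u; have [->|u0] := eqVneq u 0; first by rewrite dnorm0 normr0 mulr0.
have {u0} nu0 : 0 < `|u| by rewrite normr_gt0.
have [f fP] : {f : X * R -> X * X & forall yd, 0 < yd.2 -> `|yd.1| <= yd.2 ->
    [/\ cone (f yd).1, cone (f yd).2,
        `|yd.1 - ((f yd).1 - (f yd).2)| <= yd.2 / 2 &
        `|(f yd).1| + `|(f yd).2| <= K * yd.2] }.
  apply: (@choice _ _ (fun yd pq => 0 < yd.2 -> `|yd.1| <= yd.2 ->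
    [/\ cone pq.1, cone pq.2, `|yd.1 - (pq.1 - pq.2)| <= yd.2 / 2 &
        `|pq.1| + `|pq.2| <= K * yd.2])).
  move=> [y d]; have [[d0 yd]|nd] := pselect (0 < d /\ `|y| <= d).
    by have [p [q ?]] := app y d d0 yd; exists (p, q).
  by exists (0, 0) => /= d0 yd; exfalso; apply: nd.
pose d k : R := `|u| * 2^-1 ^+ k.
have d0 k : 0 < d k by rewrite mulr_gt0// exprn_gt0// invr_gt0.
pose y := fix y k := if k is k'.+1
  then y k' - ((f (y k', d k')).1 - (f (y k', d k')).2) else u.
have yd k : `|y k| <= d k.
  elim: k => [|k IH]; first by rewrite /d expr0 mulr1.
  have [_ _ + _] := fP (y k, d k) (d0 k) IH.
  by rewrite /d exprSr /= mulrA.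
have st k := fP (y k, d k) (d0 k) (yd k).
pose P n := \sum_(0 <= k < n) (f (y k, d k)).1.
pose Q n := \sum_(0 <= k < n) (f (y k, d k)).2.
have PS n : P n.+1 = P n + (f (y n, d n)).1 by rewrite /P sum_nat_recr.
have QS n : Q n.+1 = Q n + (f (y n, d n)).2 by rewrite /Q sum_nat_recr.
have stepC k : K * `|u| * 2^-1 ^+ k = K * d k by rewrite mulrA.
have [p Pp] : exists l : X, P @ \oo --> l.
  apply: (@cvgn_geometric_steps _ _ _ (K * `|u|) 2^-1) => [||k];
    rewrite ?invr_ge0 ?invf_lt1 ?ltr1n ?ltr0n//.
  rewrite PS addrAC subrr add0r stepC.
  by have [_ _ _ /=] := st k; apply: le_trans; rewrite lerDl.
have [q Qq] : exists l : X, Q @ \oo --> l.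
  apply: (@cvgn_geometric_steps _ _ _ (K * `|u|) 2^-1) => [||k];
    rewrite ?invr_ge0 ?invf_lt1 ?ltr1n ?ltr0n//.
  rewrite QS addrAC subrr add0r stepC.
  by have [_ _ _ /=] := st k; apply: le_trans; rewrite lerDr.
have uE n : u = P n - Q n + y n.
  elim: n => [|n IH]; first by rewrite /P /Q !big_geq// subrr add0r.
  by rewrite {1}IH PS QS /=; lmod R X.
have normPQ n : `|P n| + `|Q n| <= 2 * K * `|u|.
  (* The remaining tail [2 K d_n] is subtracted so that the induction closes: a step costs [K d_n],
     exactly the decrease of this tail. *)
  suff : `|P n| + `|Q n| <= 2 * K * `|u| - 2 * (K * d n).
    by move=> /le_trans; apply; rewrite lerBlDr lerDl !mulr_ge0// ltW.
  elim: n => [|n IH].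
    rewrite /P /Q !big_geq// !normr0 /d expr0 mulr1; lra.
  rewrite PS QS.
  have [_ _ _ /= le] := st n.
  have -> : d n.+1 = d n / 2 by rewrite /d exprSr mulrA.
  have := ler_normD (P n) (f (y n, d n)).1.
  have := ler_normD (Q n) (f (y n, d n)).2.
  lra.
have uPQ : u = p - q.
  have y0 : y @ \oo --> (0 : X).
    apply/cvgn_distP => e e0; have [N uN] := geometric_small `|u| (q := 2^-1) ltac:(lra) ltac:(lra) e0.
    by exists N => n /uN; rewrite subr0; exact: le_trans.
  have lim2 : (fun n => P n - Q n + y n) @ \oo --> p - q + 0.
    by apply: cvgD => //; apply: cvgB.
  rewrite -[RHS]addr0; apply/esym.
  apply: (cvg_unique (@norm_hausdorff _ _) lim2) => /=.
  suff -> : (fun n => P n - Q n + y n) = fun=> u by exact: cvg_cst.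
  by apply/funext => n; rewrite -uE.
have cP n : cone (P n) by apply: cone_sum => k; have [] := st k.
have cQ n : cone (Q n) by apply: cone_sum => k; have [] := st k.
have np : `|p| <= 2 * K * `|u|.
  apply: (cvgn_dist_le Pp); exists 0%N => n _.
  by apply: le_trans (normPQ n); rewrite lerDl.
have nq : `|q| <= 2 * K * `|u|.
  apply: (cvgn_dist_le Qq); exists 0%N => n _.
  by apply: le_trans (normPQ n); rewrite lerDr.
rewrite {1}uPQ; apply: (le_trans (dnorm_le _ _)).
- exact: cone_lim Pp.
- exact: cone_lim Qq.
- lra.
Qed.

End Cone.

(** * Substochastic operators *)

Section SubstochOps.
Context {R : realType} {X : completeNormedModType R}.
Variable cone : set X.
Hypothesis hX : abstract_state_space cone.
Implicit Types (P Q : X -> X) (u v : X).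

Definition substoch_op P : Prop :=
  [/\ linear P, forall u, cone u -> cone (P u)
    & forall u, cone u -> `|P u| <= `|u|].

Lemma substoch_op_lin P : substoch_op P -> linear P.
Proof. by case. Qed.

Lemma substoch_op_pos P u : substoch_op P -> cone u -> cone (P u).
Proof. by case=> _ + _; exact. Qed.

Lemma substoch_op_id : substoch_op id.
Proof. by split=> // a u v. Qed.

Lemma substoch_op_comp P Q : substoch_op P -> substoch_op Q ->
  substoch_op (P \o Q).
Proof.
move=> [lP cP nP] [lQ cQ nQ]; split=> [a u v|u cu|u cu] /=.
- by rewrite lQ lP.
- by apply: cP; exact: cQ.
- by rewrite (le_trans (nP _ (cQ _ cu)))// nQ.
Qed.

Lemma substoch_op_iter P n : substoch_op P -> substoch_op (iter n P).
Proof.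
move=> hP; elim: n => [|n IH]; first exact: substoch_op_id.
exact: substoch_op_comp.
Qed.

Lemma substoch_opZ (c : R) P : 0 <= c -> c <= 1 -> substoch_op P ->
  substoch_op (fun u => c *: P u).
Proof.
move=> c0 c1 [lP cP nP]; split=> [a u v|u cu|u cu].
- by rewrite lP; lmod R X.
- by apply: (coneZ hX) => //; exact: cP.
- by rewrite normrZ ger0_norm// (le_trans _ (nP _ cu))// ler_piMl.
Qed.

Lemma substoch_op_dnorm P u : substoch_op P -> dnorm cone (P u) <= dnorm cone u.
Proof.
move=> [lP cP nP]; apply/ler_addgt0Pr => e e0.
have [p [q [cp cq -> lt]]] := dnorm_decomp hX u e0.
rewrite (linear_B lP) (le_trans (dnorm_le hX (cP _ cp) (cP _ cq)))//.
by rewrite (le_trans _ (ltW lt))// lerD ?nP.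
Qed.

(** Boundedness is automatic: [P] contracts [dnorm], which is equivalent to the norm. *)
Lemma substoch_op_continuous P : substoch_op P -> continuous P.
Proof.
move=> hP; have [M M0 dM] := dnorm_equiv hX.
apply: (linear_bounded_continuous (substoch_op_lin hP) (M := M)) => u.
rewrite (le_trans (norm_le_dnorm hX _))//.
by rewrite (le_trans (substoch_op_dnorm _ hP)).
Qed.

Lemma substoch_op_cvg P (u : nat -> X) l : substoch_op P ->
  u @ \oo --> l -> (fun n => P (u n)) @ \oo --> P l.
Proof.
by move=> hP ul; apply: continuous_cvg => //; exact: substoch_op_continuous.
Qed.

Lemma substoch_op_lim (Ps : nat -> X -> X) P :
  (forall n, substoch_op (Ps n)) ->
  (forall u, (fun n => Ps n u) @ \oo --> P u) -> substoch_op P.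
Proof.
move=> hPs Pl; split=> [a u v|u cu|u cu].
- apply: (cvg_unique (@norm_hausdorff _ _) (Pl _)).
  suff -> : (fun n => Ps n (a *: u + v)) = fun n => a *: Ps n u + Ps n v.
    by apply: cvgD => //; exact: cvgZr.
  by apply/funext => n; have [-> _ _] := hPs n.
- by apply: (cone_lim hX _ (Pl u)) => n; have [_ + _] := hPs n; apply.
- apply: (cvgn_dist_le (Pl u)); exists 0%N => n _.
  by have [_ _] := hPs n; apply.
Qed.

Lemma cvgn_dnorm (u : nat -> X) l : u @ \oo --> l ->
  forall e : R, 0 < e ->
    exists N, forall n, (N <= n)%N -> dnorm cone (u n - l) <= e.
Proof.
have [M M0 dM] := dnorm_equiv hX.
move=> /cvgn_distP ul e e0; have [N uN] := ul (e / M) (divr_gt0 e0 M0).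
exists N => n Nn; rewrite (le_trans (dM _))// mulrC -ler_pdivlMr//.
exact: uN.
Qed.

Lemma dnorm_cvgn (u : nat -> X) l :
  (forall e : R, 0 < e ->
    exists N, forall n, (N <= n)%N -> dnorm cone (u n - l) <= e) ->
  u @ \oo --> l.
Proof.
move=> ul; apply/cvgn_distP => e e0; have [N uN] := ul e e0.
by exists N => n Nn; rewrite (le_trans (norm_le_dnorm hX _))// uN.
Qed.

Lemma dnorm_small u : (forall e : R, 0 < e -> dnorm cone u <= e) -> u = 0.
Proof.
move=> ue; apply/eqP; rewrite -normr_le0 (le_trans (norm_le_dnorm hX _))//.
by apply/ler_addgt0Pr => e e0; rewrite add0r ue.
Qed.

Lemma dnorm_dense (D : set X) :
  (forall u (e : R), 0 < e -> exists2 x, D x & `|u - x| <= e) ->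
  forall u (e : R), 0 < e -> exists2 x, D x & dnorm cone (u - x) <= e.
Proof.
have [M M0 dM] := dnorm_equiv hX.
move=> dD u e e0; have [x Dx ux] := dD u (e / M) (divr_gt0 e0 M0).
by exists x => //; rewrite (le_trans (dM _))// mulrC -ler_pdivlMr.
Qed.

(** Contraction of [dnorm], uniform in [n], carries the Cauchy property from a dense set to every
    vector. *)
Lemma substoch_ops_cvg (Ps : nat -> X -> X) (D : set X) :
  (forall n, substoch_op (Ps n)) ->
  (forall u (e : R), 0 < e -> exists2 x, D x & dnorm cone (u - x) <= e) ->
  (forall x, D x -> exists l : X, (fun n => Ps n x) @ \oo --> l) ->
  forall u, exists l : X, (fun n => Ps n u) @ \oo --> l.
Proof.
move=> hPs dD cD u; apply: cauchy_dist_cvgn => e e0.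
have [x Dx ux] := dD u (e / 4) ltac:(lra).
have [l xl] := cD x Dx; have [N lN] := (cvgn_distP _ _).1 xl (e / 4) ltac:(lra).
exists N => n m Nn nm.
have un k : `|Ps k u - Ps k x| <= e / 4.
  rewrite -(linear_B (substoch_op_lin (hPs k))).
  rewrite (le_trans (norm_le_dnorm hX _))//.
  by rewrite (le_trans (substoch_op_dnorm _ (hPs k))).
have -> : Ps n u - Ps m u = (Ps n u - Ps n x) - (Ps m u - Ps m x)
    + ((Ps n x - l) - (Ps m x - l)) by lmod R X.
have := ler_normD ((Ps n u - Ps n x) - (Ps m u - Ps m x))
  ((Ps n x - l) - (Ps m x - l)).
have := ler_normB (Ps n u - Ps n x) (Ps m u - Ps m x).
have := ler_normB (Ps n x - l) (Ps m x - l).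
have := un n; have := un m; have := lN n Nn; have := lN m (leq_trans Nn nm).
lra.
Qed.

Lemma neumann_exists P (q : R) u : substoch_op P -> 0 <= q -> q < 1 ->
  exists x, x - q *: P x = u.
Proof.
move=> hP q0 q1.
pose x := fix x n := if n is n'.+1 then u + q *: P (x n') else 0.
have lP := substoch_op_lin hP.
have xd n : dnorm cone (x n.+1 - x n) <= dnorm cone u * q ^+ n.
  elim: n => [|n IH].
    by rewrite /= (linear_0 lP) scaler0 addr0 subr0 expr0 mulr1.
  have -> : x n.+2 - x n.+1 = q *: P (x n.+1 - x n).
    by rewrite (linear_B lP) /=; lmod R X.
  rewrite (le_trans (dnormZ_ge0 hX _ q0))// exprS mulrCA ler_wpM2l//.
  by rewrite (le_trans (substoch_op_dnorm _ hP)).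
have [l xl] : exists l : X, x @ \oo --> l.
  apply: (cvgn_geometric_steps q0 q1) => k.
  exact: le_trans (norm_le_dnorm hX _) (xd k).
exists l; apply/eqP; rewrite subr_eq; apply/eqP.
have xl' : (fun n => x n.+1) @ \oo --> l by rewrite (cvg_shiftS x).
apply: (cvg_unique (@norm_hausdorff _ _) xl') => /=.
apply: cvgD; first exact: cvg_cst.
by apply: cvgZr; exact: substoch_op_cvg.
Qed.

Lemma neumann_inj P (q : R) x : substoch_op P -> 0 <= q -> q < 1 ->
  x = q *: P x -> x = 0.
Proof.
move=> hP q0 q1 xE; apply/eqP; rewrite -normr_le0.
apply: (le_trans (norm_le_dnorm hX _)).
have : dnorm cone x <= q * dnorm cone x.
  rewrite {1}xE (le_trans (dnormZ_ge0 hX _ q0))// ler_wpM2l//.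
  exact: substoch_op_dnorm.
have := dnorm_ge0 hX x; nra.
Qed.

End SubstochOps.

(** * Resolvents of generators of substochastic semigroups *)

Section Generators.
Context {R : realType} {X : completeNormedModType R}.
Implicit Types (T : R -> X -> X) (x y : X).

(** Relational form of the generator, which avoids [lim] and separate domain conditions. *)
Definition has_gen T x y : Prop := diff_quotient T x h @[h --> 0^'+] --> y.

Lemma graph_generatorP T x y : graph (generator T) (x, y) <-> has_gen T x y.
Proof.
split=> [[/= cv ->] //|xy]; split=> /=.
  by apply/cvg_ex; exists y.
by apply/esym/cvg_lim => //; exact: norm_hausdorff.
Qed.

Lemma has_gen_unique T x y z : has_gen T x y -> has_gen T x z -> y = z.
Proof. exact: (cvg_unique (@norm_hausdorff _ _)). Qed.

Lemma has_genP T x y : has_gen T x y <->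
  forall e : R, 0 < e -> exists2 d, 0 < d &
    forall h, 0 < h -> h < d -> `|T h x - x - h *: y| <= e * h.
Proof.
have E h : 0 < h -> `|T h x - x - h *: y| = h * `|diff_quotient T x h - y|.
  move=> h0; have -> : T h x - x - h *: y = h *: (diff_quotient T x h - y).
    by rewrite /diff_quotient; lmod R X; rewrite gt_eqF.
  by rewrite normrZ gtr0_norm.
split=> [/cvg_at_right0P xy e e0|xy].
  have [d d0 dP] := xy e e0; exists d => // h h0 hd.
  by rewrite E// mulrC ler_pM2r//; exact: dP.
apply/cvg_at_right0P => e e0; have [d d0 dP] := xy e e0.
exists d => // h h0 hd; have := dP h h0 hd.
by rewrite E// mulrC ler_pM2r.
Qed.

Lemma has_gen_linear T (a : R) x y x' y' :
  (forall t, 0 <= t -> linear (T t)) ->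
  has_gen T x y -> has_gen T x' y' -> has_gen T (a *: x + x') (a *: y + y').
Proof.
move=> lT xy xy'; apply/cvg_at_right0P => e e0.
have : (a *: diff_quotient T x h + diff_quotient T x' h) @[h --> 0^'+]
    --> a *: y + y' by apply: cvgD => //; exact: cvgZr.
move=> /cvg_at_right0P/(_ e e0)[d d0 dP]; exists d => // h h0 hd.
have -> : diff_quotient T (a *: x + x') h =
    a *: diff_quotient T x h + diff_quotient T x' h.
  by rewrite /diff_quotient lT ?ltW//; lmod R X.
exact: dP.
Qed.

(** Rescaling shifts the generator by [-c], so that [x] is the resolvent at [c] of [u] exactly when
    the damped generator sends [x] to [- u]. The damped semigroup also decays, which replaces
    improper integrals by limits over integer times. *)
Definition damped (c : R) T (t : R) (u : X) : X := expR (- (c * t)) *: T t u.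

Lemma dampedK c T : damped (- c) (damped c T) = T.
Proof.
apply/funext => t; apply/funext => u.
by rewrite /damped scalerA -expRD mulNr opprK subrr expR0 scale1r.
Qed.

Lemma expR_right_derivative (c : R) :
  h^-1 * (expR (- (c * h)) - 1) @[h --> 0^'+] --> - c.
Proof.
have D : is_derive (0 : R) 1 (fun h => expR (- (c * h))) (- c).
  apply: is_derive_eq.
  by rewrite !(mulr0, oppr0, expR0) /GRing.scale /= !(mulr1, mul1r, addr0, mul0r).
have := @ex_derive _ _ _ _ _ _ _ D.
rewrite /derivable -/(derive _ _ _) => /cvg_dnbhs_at_right.
rewrite -/(derive _ _ _) (@derive_val _ _ _ _ _ _ _ D).
apply: cvg_trans; apply: near_eq_cvg; near=> h => /=.
by rewrite addr0 mulr0 oppr0 expR0 /GRing.scale /= mulr1.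
Unshelve. all: by end_near. Qed.

Lemma has_gen_damped c T x y :
  has_gen T x y -> has_gen (damped c T) x (y - c *: x).
Proof.
move=> xy; rewrite /has_gen.
have e1 : expR (- (c * h)) @[h --> 0^'+] --> (1 : R).
  apply: cvg_at_right_filter; rewrite -[X in _ --> X]expR0 -[X in expR X]oppr0.
  rewrite -[X in - X](mulr0 c); apply: continuous_cvg; first exact: continuous_expR.
  by apply: cvgN; apply: cvgMr; exact: cvg_id.
have : (expR (- (c * h)) *: diff_quotient T x h +
    (h^-1 * (expR (- (c * h)) - 1)) *: x) @[h --> 0^'+] --> 1 *: y + (- c) *: x.
  by apply: cvgD; [exact: cvgZ|apply: cvgZl; exact: expR_right_derivative].
rewrite scale1r scaleNr; apply: cvg_trans; apply: near_eq_cvg; near=> h.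
by rewrite /diff_quotient /damped; lmod R X.
Unshelve. all: by end_near. Qed.

Lemma has_gen_dampedE c T x y :
  has_gen (damped c T) x y <-> has_gen T x (y + c *: x).
Proof.
split=> [/(has_gen_damped (c := - c))|/(has_gen_damped (c := c))].
  by rewrite dampedK scaleNr opprK.
by rewrite addrK.
Qed.

End Generators.

(** * Riemann sums of orbits and the order of resolvents *)

Section SubstochasticSemigroups.
Context {R : realType} {X : completeNormedModType R}.
Variable cone : set X.
Hypothesis hX : abstract_state_space cone.
Implicit Types (T S : R -> X -> X) (u x y z : X).
Local Notation dnorm := (dnorm cone).

Lemma substochastic_op T (t : R) : substochastic cone T -> 0 <= t ->
  substoch_op cone (T t).
Proof.
move=> [hT cT nT] t0; split; first exact: semigroup_linear hT t t0.
- by move=> u; exact: cT.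
- by move=> u; exact: nT.
Qed.

Lemma substochastic_damped (c : R) T : 0 <= c -> substochastic cone T ->
  substochastic cone (damped c T).
Proof.
move=> c0 hT; have op t : 0 <= t -> substoch_op cone (damped c T t).
  move=> t0; apply: (substoch_opZ hX); [exact: expR_ge0| |exact: substochastic_op].
  by rewrite expR_le1 oppr_le0 mulr_ge0.
split; [split| |].
- by move=> t t0; exact: substoch_op_lin (op t t0).
- by move=> t t0; exact: substoch_op_continuous (op t t0).
- by move=> u; have [hC _ _] := hT; rewrite /damped mulr0 oppr0 expR0 scale1r (semigroup0 hC).
- move=> s t s0 t0 u; have [hC _ _] := hT; rewrite /damped.
  rewrite (semigroupD hC)// (linear_Z (semigroup_linear hC s0)) scalerA -expRD.
  by rewrite mulrDr opprD.
- move=> u; have [hC _ _] := hT.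
  rewrite -[X in _ --> X]scale1r; apply: cvgZ; last exact: semigroup_strong hC u.
  apply: cvg_at_right_filter; rewrite -[X in _ --> X]expR0 -[X in expR X]oppr0.
  rewrite -[X in - X](mulr0 c); apply: continuous_cvg; first exact: continuous_expR.
  by apply: cvgN; apply: cvgMr; exact: cvg_id.
- by move=> t u t0; exact: substoch_op_pos (op t t0).
- by move=> t u t0 cu; have [_ _] := op t t0; apply.
Qed.

Lemma has_gen_dnorm T x y : has_gen T x y ->
  forall e : R, 0 < e -> exists2 d, 0 < d &
    forall h, 0 < h -> h < d -> dnorm (T h x - x - h *: y) <= e * h.
Proof.
have [M M0 dM] := dnorm_equiv hX.
move=> /has_genP xy e e0; have [d d0 dP] := xy (e / M) (divr_gt0 e0 M0).
exists d => // h h0 hd; rewrite (le_trans (dM _))//.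
have := dP h h0 hd; rewrite -(ler_pM2l M0); congr (_ <= _).
by field; rewrite gt_eqF.
Qed.

Section OneSemigroup.
Variable S : R -> X -> X.
Hypothesis hS : substochastic cone S.

Let hC : C0_semigroup S := let: And3 h _ _ := hS in h.

Let opS (t : R) : 0 <= t -> substoch_op cone (S t).
Proof. exact: substochastic_op hS. Qed.

Lemma semigroup_near0 u (e : R) : 0 < e ->
  exists2 d, 0 < d & forall s, 0 <= s -> s < d -> dnorm (S s u - u) <= e.
Proof.
have [M M0 dM] := dnorm_equiv hX; move=> e0.
have [d d0 dP] := (cvg_at_right0P _ _).1 (@semigroup_strong _ _ _ hC u)
  (e / M) (divr_gt0 e0 M0).
exists d => // s; rewrite le_eqVlt => /predU1P[<- _|s0 sd].
  by rewrite (semigroup0 hC) subrr (dnorm0 hX) ltW.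
by rewrite (le_trans (dM _))// mulrC -ler_pdivlMr//; exact: dP.
Qed.

(** Left Riemann sum with step [h] for the integral of [S s u] over [[0, n h]]. *)
Definition rsum (h : R) (n : nat) (u : X) : X :=
  h *: \sum_(0 <= k < n) S (k%:R * h) u.

Lemma rsumD (h : R) m n u : 0 <= h ->
  rsum h (m + n) u = rsum h m u + S (m%:R * h) (rsum h n u).
Proof.
move=> h0; rewrite /rsum; have lS := semigroup_linear hC (mulr_ge0 (ler0n R m) h0).
rewrite (linear_Z lS) (linear_sum lS) -scalerDr; congr (_ *: _).
elim: n => [|n IH]; first by rewrite addn0 [X in _ = _ + X]big_geq// addr0.
rewrite addnS !sum_nat_recr IH -addrA; congr (_ + (_ + _)).
by rewrite -(semigroupD hC) ?mulr_ge0// natrD mulrDl.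
Qed.

Lemma rsum_telescope (h : R) n x : 0 <= h ->
  x - S (n%:R * h) x = \sum_(0 <= k < n) S (k%:R * h) (x - S h x).
Proof.
move=> h0; elim: n => [|n IH]; first by rewrite big_geq// mul0r (semigroup0 hC) subrr.
rewrite sum_nat_recr -IH (linear_B (semigroup_linear hC _)) ?mulr_ge0//.
have -> : S (n.+1%:R * h) x = S (n%:R * h) (S h x).
  by rewrite -(semigroupD hC) ?mulr_ge0// -natr1 mulrDl mul1r.
by lmod R X.
Qed.

Lemma rsum_dist (h : R) n u (w : R) : 0 <= h ->
  (forall s, 0 <= s -> s <= n%:R * h -> dnorm (S s u - u) <= w) ->
  dnorm (rsum h n u - (n%:R * h) *: u) <= n%:R * h * w.
Proof.
move=> h0 uw.
have -> : rsum h n u - (n%:R * h) *: u =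
    h *: \sum_(0 <= k < n) (S (k%:R * h) u - u).
  by rewrite sumrB sumr_const_nat subn0 scalerBr -(scaler_nat n u) scalerA mulrC.
rewrite (le_trans (dnormZ_ge0 hX _ h0))//.
have -> : n%:R * h * w = h * (n%:R * w) by ring.
rewrite ler_wpM2l//.
apply: (dnorm_sum_le hX) => k kn.
by apply: uw; rewrite ?mulr_ge0// ler_wpM2r// ler_nat ltnW.
Qed.

(** Each coarse step is compared with the [k] fine ones inside it. At time 0 the discrepancy is that
    of replacing [S s u] by [u]; at later times [S] transports it and contracts [dnorm]. *)
Lemma rsum_refine (h : R) n k u (w : R) : 0 <= h ->
  (forall s, 0 <= s -> s <= k%:R * h -> dnorm (S s u - u) <= w) ->
  dnorm (rsum h (n * k) u - rsum (k%:R * h) n u) <= n%:R * (k%:R * h * w).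
Proof.
move=> h0 uw; have kh0 : 0 <= k%:R * h by rewrite mulr_ge0.
elim: n => [|n IH].
  by rewrite mul0n /rsum !big_geq// !scaler0 subrr (dnorm0 hX) mul0r.
rewrite mulSn addnC rsumD// -addn1 rsumD//.
have -> : rsum (k%:R * h) 1 u = (k%:R * h) *: u.
  by rewrite /rsum big_nat1 mul0r (semigroup0 hC).
have -> : (n * k)%:R * h = n%:R * (k%:R * h) by rewrite natrM mulrA.
have nkh0 : 0 <= n%:R * (k%:R * h) by rewrite mulr_ge0.
have -> : rsum h (n * k) u + S (n%:R * (k%:R * h)) (rsum h k u) -
    (rsum (k%:R * h) n u + S (n%:R * (k%:R * h)) ((k%:R * h) *: u)) =
    (rsum h (n * k) u - rsum (k%:R * h) n u) +
    S (n%:R * (k%:R * h)) (rsum h k u - (k%:R * h) *: u).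
  by rewrite (linear_B (semigroup_linear hC nkh0)); lmod R X.
rewrite (le_trans (dnormD hX _ _))// natrD mulrDl mul1r lerD//.
by rewrite (le_trans (substoch_op_dnorm hX _ (opS nkh0)))// rsum_dist.
Qed.

(** Fundamental theorem of calculus: [x - S h x] is [h u] up to [o(h)], and the [n.+1] translates of
    this error, summed along the telescoping of [x - S t x], stay small. *)
Lemma rsum_generator x u (t : R) : 0 <= t -> has_gen S x (- u) ->
  (fun n => rsum (t / n.+1%:R) n.+1 u) @ \oo --> x - S t x.
Proof.
move=> t0 xu; apply: (dnorm_cvgn hX) => e e0.
(* [t + 1] instead of [t] allows [t = 0]. *)
have t10 : 0 < t + 1 by lra.
have [d d0 dP] := has_gen_dnorm xu (divr_gt0 e0 t10).
exists (Num.truncn (t / d)) => n Nn.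
set h := t / n.+1%:R.
have h0 : 0 <= h by rewrite divr_ge0.
have nh : n.+1%:R * h = t by rewrite /h mulrC divfK// pnatr_eq0.
have hd : h < d.
  rewrite ltr_pdivrMr ?ltr0n// mulrC -ltr_pdivrMr//.
  by rewrite (lt_le_trans (truncnS_gt _))// ler_nat ltnS.
have -> : rsum h n.+1 u - (x - S t x) =
    \sum_(0 <= k < n.+1) S (k%:R * h) (S h x - x - h *: (- u)).
  rewrite -nh rsum_telescope// /rsum scaler_sumr -sumrB.
  apply: eq_bigr => k _.
  have lS := semigroup_linear hC (mulr_ge0 (ler0n R k) h0).
  by rewrite -(linear_Z lS) -(linear_B lS); congr (S _ _); lmod R X.
apply: (@le_trans _ _ (n.+1%:R * (e / (t + 1) * h))).
  apply: (dnorm_sum_le hX) => k _.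
  rewrite (le_trans (substoch_op_dnorm hX _ (opS _))) ?mulr_ge0//.
  move: h0; rewrite le_eqVlt => /predU1P[<-|h0]; last exact: dP.
  by rewrite (semigroup0 hC) scale0r !subrr (dnorm0 hX) mulr0.
by rewrite mulrCA nh mulrAC ler_pdivrMr// ler_wpM2l ?ltW//; lra.
Qed.

End OneSemigroup.

(* The Riemann sums of the two resolvent integrals compare termwise. *)
Lemma generator_le S S' x y u : substochastic cone S -> substochastic cone S' ->
  (forall t w, 0 <= t -> cone w -> cone (S' t w - S t w)) -> cone u ->
  has_gen S x (- u) -> has_gen S' y (- u) ->
  forall t, 0 <= t -> cone ((y - S' t y) - (x - S t x)).
Proof.
move=> hS hS' SS' cu xu yu t t0.
have lim_diff : (fun n => rsum S' (t / n.+1%:R) n.+1 u - rsum S (t / n.+1%:R) n.+1 u)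
    @ \oo --> (y - S' t y) - (x - S t x).
  by apply: cvgB; exact: rsum_generator.
apply: (cone_lim hX _ lim_diff) => n.
rewrite /rsum -scalerBr -sumrB; apply: (coneZ hX); first exact: divr_ge0.
apply: (cone_sum hX) => k; apply: SS' => //.
by rewrite mulr_ge0// divr_ge0.
Qed.

Lemma generator_pos S x u t : substochastic cone S -> cone u ->
  has_gen S x (- u) -> 0 <= t -> cone (x - S t x).
Proof.
move=> hS cu xu t0; apply: (cone_lim hX _ (rsum_generator hS t0 xu)) => n.
rewrite /rsum; apply: (coneZ hX); first exact: divr_ge0.
apply: (cone_sum hX) => k; apply: (substoch_op_pos (substochastic_op hS _)) => //.
by rewrite mulr_ge0// divr_ge0.
Qed.

End SubstochasticSemigroups.

(** * The integral of an orbit over the unit interval *)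

Section SemigroupIntegral.
Context {R : realType} {X : completeNormedModType R}.
Variable cone : set X.
Hypothesis hX : abstract_state_space cone.
Variable S : R -> X -> X.
Hypothesis hS : substochastic cone S.
Local Notation dnorm := (dnorm cone).

Let hC : C0_semigroup S := let: And3 h _ _ := hS in h.

Let opS (t : R) : 0 <= t -> substoch_op cone (S t).
Proof. exact: substochastic_op hS. Qed.

Lemma small_time (u : X) (e : R) : 0 < e -> exists2 N, (0 < N)%N &
  forall n s, (N <= n)%N -> 0 <= s -> s <= 2^-1 ^+ n -> dnorm (S s u - u) <= e.
Proof.
move=> e0; have [d d0 dP] := semigroup_near0 hX hS u e0.
have [N dN] := geometric_small 1 (q := 2^-1 : R) ltac:(lra) ltac:(lra) (e := d / 2) ltac:(lra).
exists N.+1 => // n s Nn s0 sn; apply: dP => //.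
have := dN n (ltnW Nn); rewrite mul1r; lra.
Qed.

(* The limit plays the role of the integral of [S s z] over [0 <= s <= 1]. *)
Lemma dyadic_rsum_cvg (z : X) : exists I : X,
  (fun n => rsum S (2^-1 ^+ n) (2 ^ n) z) @ \oo --> I.
Proof.
apply: cauchy_dist_cvgn => e e0.
have [N N0 NP] := small_time z e0.
exists N => n m Nn nm; rewrite distrC.
pose h : R := 2^-1 ^+ m; pose k := (2 ^ (m - n))%N.
have h0 : 0 <= h by rewrite exprn_ge0// invr_ge0.
have kh : k%:R * h = 2^-1 ^+ n.
  rewrite /k /h -[X in _ ^+ X](subnKC nm) exprD mulrCA natrX -exprMn.
  by rewrite mulfV ?expr1n ?mulr1// pnatr_eq0.
have nk : (2 ^ m = 2 ^ n * k)%N by rewrite /k -expnD subnKC.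
rewrite nk -kh (le_trans (norm_le_dnorm hX _))//.
have kw s : 0 <= s -> s <= k%:R * h -> dnorm (S s z - z) <= e.
  by rewrite kh => s0 sn; exact: (NP n).
rewrite (le_trans (rsum_refine hX hS (2 ^ n) h0 kw))// kh mulrA natrX -exprMn.
by rewrite mulfV ?expr1n ?mul1r// pnatr_eq0.
Qed.

(** For the integral [I] of the orbit of [z] over [[0, 1]], [S s I - I] equals [S 1 r - r] with [r]
    the integral over [[0, s]], and [r] is close to [s z]. This is proved for the dyadic sums, with
    [s] replaced by a grid point, before the limit is taken. *)
Lemma integral_generator (z : X) : exists I, has_gen S I (S 1 z - z).
Proof.
have [I II] := dyadic_rsum_cvg z; exists I; apply/has_genP => e e0.
have [d d0 dP] := semigroup_near0 hX hS z (e := e / 2) ltac:(lra).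
exists d => // s s0 sd.
(* [sn n] is [s] rounded down to the grid of step [h n]. Rounding down keeps [s - sn n] nonnegative,
   so strong continuity at 0 is enough to pass to the limit. *)
pose h n : R := 2^-1 ^+ n; pose j n := Num.truncn (s * 2 ^+ n).
pose sn n := (j n)%:R * h n.
have h0 n : 0 < h n by rewrite exprn_gt0// invr_gt0.
have hE n : 2 ^+ n * h n = 1 by rewrite /h -exprMn mulfV ?expr1n// pnatr_eq0.
have h_ge0 n : 0 <= h n := ltW (h0 n).
have sn0 n : 0 <= sn n by rewrite mulr_ge0.
have s2 n : 0 <= s * 2 ^+ n by rewrite mulr_ge0 ?exprn_ge0// ltW.
have sn_le n : sn n <= s.
  rewrite -[leRHS]mulr1 -(hE n) mulrA ler_wpM2r//.
  by rewrite truncn_le.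
have sn_ge n : s - sn n <= h n.
  rewrite lerBlDr -{1}[s]mulr1 -(hE n) mulrA /sn.
  by rewrite -[X in _ <= X + _]mul1r -mulrDl ler_wpM2r// addrC natr1 ltW// truncnS_gt.
pose J n := rsum S (h n) (2 ^ n) z.
have nh n : (2 ^ n)%:R * h n = 1 by rewrite natrX.
(* The sum over [[0, 1 + sn n]] is cut once at 1 and once at [sn n]. *)
have JE n : S (sn n) (J n) - J n = S 1 (rsum S (h n) (j n) z) - rsum S (h n) (j n) z.
  have := rsumD hS (2 ^ n) (j n) z (h_ge0 n).
  rewrite addnC (rsumD hS)// nh -/(sn n) => E.
  have -> : S (sn n) (J n) = J n + S 1 (rsum S (h n) (j n) z) - rsum S (h n) (j n) z.
    by rewrite -E addrC addKr.
  by lmod R X.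
have Jd n : dnorm (S (sn n) (J n) - J n - sn n *: (S 1 z - z)) <= e * s.
  rewrite JE; set r := rsum _ _ _ _.
  have -> : S 1 r - r - sn n *: (S 1 z - z) =
      S 1 (r - sn n *: z) - (r - sn n *: z).
    have l1 : linear (S 1) by apply: (semigroup_linear hC); exact: ler01.
    by rewrite (linear_B l1) (linear_Z l1 (sn n)); lmod R X.
  have rz : dnorm (r - sn n *: z) <= sn n * (e / 2).
    apply: (rsum_dist hX) => // t t0 tn; apply: dP => //.
    by rewrite (le_lt_trans tn)// (le_lt_trans (sn_le n)).
  rewrite (le_trans (dnormB hX _ _))//.
  have := substoch_op_dnorm hX (r - sn n *: z) (opS ler01).
  have : sn n * (e / 2) <= s * (e / 2) by rewrite ler_wpM2r//; lra.
  lra.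
have h_small t : 0 < t -> exists N, forall n, (N <= n)%N -> h n <= t.
  move=> t0; have [N NP] := geometric_small 1 (q := 2^-1 : R) ltac:(lra) ltac:(lra) t0.
  by exists N => n /NP; rewrite mul1r.
have lim1 : (fun n => S (sn n) (J n)) @ \oo --> S s I.
  apply: (dnorm_cvgn hX) => t t0.
  have [d' d'0 d'P] := semigroup_near0 hX hS I (e := t / 2) ltac:(lra).
  have [N1 N1P] := h_small (d' / 2) ltac:(lra).
  have [N2 N2P] := cvgn_dnorm hX II (e := t / 2) ltac:(lra).
  exists (maxn N1 N2) => n; rewrite geq_max => /andP[n1 n2].
  have lS := semigroup_linear hC (sn0 n).
  have -> : S (sn n) (J n) - S s I =
      S (sn n) (J n - I) - S (sn n) (S (s - sn n) I - I).
    have -> : S s I = S (sn n) (S (s - sn n) I).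
      by rewrite -(semigroupD hC) ?subr_ge0// addrC subrK.
    by rewrite !(linear_B lS); lmod R X.
  rewrite (le_trans (dnormB hX _ _))//.
  have := substoch_op_dnorm hX (J n - I) (opS (sn0 n)).
  have := substoch_op_dnorm hX (S (s - sn n) I - I) (opS (sn0 n)).
  have : dnorm (S (s - sn n) I - I) <= t / 2.
    apply: d'P; first by rewrite subr_ge0.
    have := sn_ge n; have := N1P n n1; lra.
  have := N2P n n2; rewrite -/(h n) -/(J n); lra.
have lim2 : sn @ \oo --> s.
  apply/cvgrPdist_le => t t0; have [N NP] := h_small t t0.
  exists N => // n /= Nn; rewrite ger0_norm ?subr_ge0//.
  exact: le_trans (sn_ge n) (NP n Nn).
have lim3 : (fun n => S (sn n) (J n) - J n - sn n *: (S 1 z - z)) @ \oo -->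
    S s I - I - s *: (S 1 z - z).
  by apply: cvgB; [exact: cvgB|exact: cvgZl].
apply: (cvgn_dist_le lim3); exists 0%N => n _.
exact: le_trans (norm_le_dnorm hX _) (Jd n).
Qed.

End SemigroupIntegral.

(** * Existence, positivity and approximation properties of resolvents *)

Section Resolvents.
Context {R : realType} {X : completeNormedModType R}.
Variable cone : set X.
Hypothesis hX : abstract_state_space cone.
Variable T : R -> X -> X.
Hypothesis hT : substochastic cone T.
Local Notation dnorm := (dnorm cone).

Let hC : C0_semigroup T := let: And3 h _ _ := hT in h.

Lemma damped_cvg0 (c : R) x : 0 < c ->
  (fun n => damped c T n%:R x) @ \oo --> 0.
Proof.
move=> c0; apply: (dnorm_cvgn hX) => e e0.
have q0 : 0 <= expR (- c) := expR_ge0 _.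
have q1 : expR (- c) < 1 by rewrite expR_lt1 oppr_lt0.
have [N NP] := geometric_small (dnorm x) q0 q1 e0.
exists N => n Nn; rewrite subr0 (le_trans _ (NP n Nn))// /damped.
rewrite (le_trans (dnormZ_ge0 hX _ (expR_ge0 _)))// mulrC -mulNr expRM_natr.
rewrite ler_wpM2r ?exprn_ge0//.
exact: (substoch_op_dnorm hX _ (substochastic_op hT _)).
Qed.

(** No integral over the half-line is needed: with [S] the damped semigroup, a Neumann series gives
    [z] with [z - S 1 z = u], and the integral of the orbit of [z] over [[0, 1]] is sent by the
    generator of [S] to [S 1 z - z = - u]. *)
Lemma resolvent_exists (c : R) u : 0 < c -> exists x, has_gen T x (c *: x - u).
Proof.
move=> c0; have hS := substochastic_damped hX (ltW c0) hT.
have [|z zu] := neumann_exists hX u (substochastic_op hT ler01) (expR_ge0 (- c)).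
  by rewrite expR_lt1 oppr_lt0.
have [x xz] := integral_generator hX hS z; exists x.
have : has_gen (damped c T) x (- u).
  by rewrite -zu opprB; move: xz; rewrite /damped mulr1.
by move=> /has_gen_dampedE; rewrite addrC.
Qed.

(** [x] is the limit of [x - S n x] for the damped semigroup [S], and these vectors are limits of
    positive Riemann sums. *)
Lemma resolvent_pos (c : R) x u : 0 < c -> cone u ->
  has_gen T x (c *: x - u) -> cone x.
Proof.
move=> c0 cu xu; have hS := substochastic_damped hX (ltW c0) hT.
have xuS : has_gen (damped c T) x (- u) by apply/has_gen_dampedE; rewrite addrC.
have lim : (fun n => x - damped c T n%:R x) @ \oo --> x - 0.
  by apply: cvgB; [exact: cvg_cst|exact: damped_cvg0].
rewrite -[x]subr0; apply: (cone_lim hX _ lim) => n.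
exact: generator_pos hS cu xuS _.
Qed.

Lemma generator_dissipative (Psi : X -> R) x y : norm_functional cone Psi ->
  cone x -> has_gen T x y -> Psi y <= 0.
Proof.
move=> [lPsi cPsi nPsi] cx xy.
have [_ cT nT] := hT.
have lim : Psi (diff_quotient T x h) @[h --> 0^'+] --> Psi y.
  by apply: continuous_cvg => //; exact: cPsi.
apply: (@closed_cvg _ _ _ _ _ (fun r : R => r <= 0) _ _ _ lim).
  exact: closed_le.
near=> h; have h0 : 0 < h by [].
rewrite /diff_quotient.
have lP : linear (Psi : X -> R^o) by move=> a u v; rewrite lPsi.
rewrite (linear_Z lP) (linear_B lP) (nPsi (T h x)); last by apply: cT => //; exact: ltW.
rewrite nPsi//.
rewrite /GRing.scale /= pmulr_rle0 ?invr_gt0// subr_le0.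
by apply: nT => //; exact: ltW.
Unshelve. all: by end_near. Qed.

End Resolvents.

Section ResolventOperator.
Context {R : realType} {X : completeNormedModType R}.
Variable cone : set X.
Hypothesis hX : abstract_state_space cone.
Variable T : R -> X -> X.
Hypothesis hT : substochastic cone T.
Local Notation dnorm := (dnorm cone).
Local Notation res := (resolvent (generator T)).

Let hC : C0_semigroup T := let: And3 h _ _ := hT in h.

Lemma has_gen_resolvent (c : R) u : 0 < c ->
  has_gen T (res c u) (c *: res c u - u).
Proof.
move=> c0; have [x xu] := resolvent_exists hX hT u c0.
suff [dx xE] : dom (generator T) (res c u) /\
    c *: res c u - generator T (res c u) = u.
  by apply/graph_generatorP; split=> //=; rewrite -[X in _ - X = _]xE opprB addrC subrK.
apply: (@xgetPex _ 0 [set v | dom (generator T) v /\ c *: v - generator T v = u]).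
exists x; have [/= dx xE] := (graph_generatorP _ _ _).2 xu; split=> //.
by rewrite -xE opprB addrC subrK.
Qed.

(** Uniqueness comes from positivity: the difference of two solutions and its opposite both solve
    the equation with right-hand side 0, so both lie in the cone. *)
Lemma has_gen_inj (c : R) x x' u : 0 < c ->
  has_gen T x (c *: x - u) -> has_gen T x' (c *: x' - u) -> x = x'.
Proof.
have lin := semigroup_linear hC.
have pos v w : 0 < c -> has_gen T v (c *: v - u) -> has_gen T w (c *: w - u) ->
    cone (w - v).
  move=> c0 vu wu; apply: (resolvent_pos hX hT c0 (cone0 hX)).
  have -> : w - v = (-1) *: v + w by lmod R X.
  have -> : c *: (-1 *: v + w) - 0 = (-1) *: (c *: v - u) + (c *: w - u).
    by lmod R X.
  exact: has_gen_linear.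
by move=> c0 xu xu'; apply: (cone_antisym hX); exact: pos.
Qed.

Lemma resolventE (c : R) x y : 0 < c -> has_gen T x y -> res c (c *: x - y) = x.
Proof.
move=> c0 xy; apply: (has_gen_inj c0 (has_gen_resolvent c0)).
by rewrite opprB addrC subrK.
Qed.

Lemma resolvent_linear (c : R) : 0 < c -> linear (res c).
Proof.
move=> c0 a u v; apply: (has_gen_inj c0 (has_gen_resolvent c0)).
have -> : c *: (a *: res c u + res c v) - (a *: u + v) =
    a *: (c *: res c u - u) + (c *: res c v - v) by lmod R X.
by apply: has_gen_linear; [exact: semigroup_linear hC| |]; exact: has_gen_resolvent.
Qed.

Lemma generator_translate (t : R) x y : 0 <= t -> has_gen T x y ->
  has_gen T (T t x) (T t y).
Proof.
move=> t0 xy; have ct := semigroup_continuous hC t0.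
have lim : T t (diff_quotient T x h) @[h --> 0^'+] --> T t y.
  by apply: continuous_cvg => //; exact: ct.
apply: cvg_trans lim; apply: near_eq_cvg; near=> h.
have h0 : 0 < h by [].
have lt : linear (T t) by apply: (semigroup_linear hC).
rewrite /diff_quotient (linear_Z lt) (linear_B lt).
by rewrite -!(semigroupD hC) ?(ltW h0)// (addrC t h).
Unshelve. all: by end_near. Qed.

(** With [x = res 1 u] one has [u = x - A x]; replacing [A x] by a difference quotient of [x] gives
    vectors of the domain that tend to [u]. *)
Lemma generator_dense (u : X) (e : R) : 0 < e ->
  exists2 x, (exists y, has_gen T x y) & `|u - x| <= e.
Proof.
move=> e0; have xu := @has_gen_resolvent 1 u ltr01.
set x := res 1 u in xu; rewrite scale1r in xu.
have [d d0 dP] := (cvg_at_right0P _ _).1 xu e e0.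
exists (x - diff_quotient T x (d / 2)); last first.
  have := dP (d / 2) ltac:(lra) ltac:(lra); set q := diff_quotient _ _ _.
  by have -> : q - (x - u) = u - (x - q) by lmod R X.
exists (- ((d / 2)^-1 *: (T (d / 2) (x - u) - (x - u))) + (x - u)).
have lin := semigroup_linear hC.
have d2 : 0 <= d / 2 by lra.
have -> : x - diff_quotient T x (d / 2) =
    - (d / 2)^-1 *: ((-1) *: x + T (d / 2) x) + x.
  by rewrite /diff_quotient; lmod R X; lra.
have -> : - ((d / 2)^-1 *: (T (d / 2) (x - u) - (x - u))) + (x - u) =
    - (d / 2)^-1 *: ((-1) *: (x - u) + T (d / 2) (x - u)) + (x - u).
  by lmod R X; lra.
apply: has_gen_linear => //; apply: has_gen_linear => //.
exact: generator_translate.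
Qed.

Variable Psi : X -> R.
Hypothesis hPsi : norm_functional cone Psi.

Lemma functional_linear : linear (Psi : X -> R^o).
Proof. by have [l _ _] := hPsi => a u v; rewrite l. Qed.

Lemma functional_D u v : Psi (u + v) = Psi u + Psi v.
Proof. exact: (linear_D functional_linear). Qed.

Lemma functional_B u v : Psi (u - v) = Psi u - Psi v.
Proof. exact: (linear_B functional_linear). Qed.

Lemma functional_Z c u : Psi (c *: u) = c * Psi u.
Proof. exact: (linear_Z functional_linear). Qed.

Lemma functional_norm u : cone u -> Psi u = `|u|.
Proof. by have [_ _] := hPsi; apply. Qed.

Lemma resolvent_op (c : R) : 0 < c -> substoch_op cone (fun u => c *: res c u).
Proof.
move=> c0; have pos u : cone u -> cone (res c u).
  by move=> cu; apply: (resolvent_pos hX hT c0 cu); exact: has_gen_resolvent.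
split=> [a u v|u cu|u cu].
- by rewrite resolvent_linear//; lmod R X.
- by apply: (coneZ hX); [exact: ltW|exact: pos].
- have := generator_dissipative hT hPsi (pos _ cu) (@has_gen_resolvent c u c0).
  rewrite (linear_B functional_linear) !functional_norm ?subr_le0//.
  by apply: (coneZ hX); [exact: ltW|exact: pos].
Qed.

Lemma resolvent_approx (u : X) (e : R) : 0 < e ->
  exists2 L, 0 < L & forall c, L <= c -> dnorm (c *: res c u - u) <= e.
Proof.
move=> e0.
have dD := @dnorm_dense _ _ _ hX (fun x => exists y, has_gen T x y) generator_dense.
have [x [y xy] ux] := dD u (e / 3) ltac:(lra).
have n1 : 0 < dnorm y + 1 by have := dnorm_ge0 hX y; lra.
(* For [x] in the domain with image [y], [c *: res c x - x = res c y] has [dnorm] at most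
   [dnorm y / c], which this threshold keeps below [e / 3]. Replacing [u] by [x] costs [2 e / 3]. *)
exists (3 * (dnorm y + 1) / e); first by rewrite divr_gt0// mulr_gt0.
move=> c Lc.
have c0 : 0 < c by apply: lt_le_trans Lc; rewrite divr_gt0// mulr_gt0.
have opc := resolvent_op c0.
have -> : c *: res c u - u =
    (c *: res c (u - x)) - (u - x) + c^-1 *: (c *: res c y).
  have lr := resolvent_linear c0.
  have {2}-> : u = (u - x) + res c (c *: x - y) by rewrite resolventE// subrK.
  by rewrite !(linear_B lr) (linear_Z lr); lmod R X; rewrite gt_eqF.
have := dnormD hX (c *: res c (u - x) - (u - x)) (c^-1 *: (c *: res c y)).
have := dnormB hX (c *: res c (u - x)) (u - x).
have := substoch_op_dnorm hX (u - x) opc.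
have : dnorm (c^-1 *: (c *: res c y)) <= e / 3.
  have ci : 0 <= c^-1 by rewrite invr_ge0 ltW.
  rewrite (le_trans (dnormZ_ge0 hX _ ci))//.
  rewrite ler_pdivrMl//.
  have := substoch_op_dnorm hX y opc.
  have : 3 * (dnorm y + 1) <= c * e by rewrite -ler_pdivrMr.
  lra.
lra.
Qed.

End ResolventOperator.

(** * The minimal resolvent of the perturbed generator *)

Section Kato.
Context {R : realType} {X : completeNormedModType R}.
Variables (cone : set X) (Psi : X -> R) (U : R -> X -> X) (B : X -> X).
Hypothesis hX : abstract_state_space cone.
Hypothesis hPsi : norm_functional cone Psi.
Hypothesis hU : substochastic cone U.
Hypothesis hBlin : linear_on (dom (generator U)) B.
Hypothesis hBpos : positive_on cone (dom (generator U)) B.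
Hypothesis hAB : forall u, dom (generator U) u -> cone u ->
  Psi (generator U u + B u) <= 0.
Local Notation res := (resolvent (generator U)).

Let psiD := functional_D hPsi.
Let psiB := functional_B hPsi.
Let psiZ := functional_Z hPsi.
Let nPsi u : cone u -> Psi u = `|u| := functional_norm hPsi (u := u).

Definition kato_jump (c : R) (u : X) : X := B (res c u).

(** The sum of the [J^k u] for [k < n] in Horner form. By conversion the source at [n.+1] is
    [u + B v_n], with [v_n] the approximation below; the comparisons of two parameters rest on this
    form. *)
Fixpoint kato_source (c : R) (n : nat) (u : X) : X :=
  if n is n'.+1 then u + kato_jump c (kato_source c n' u) else 0.

Definition kato_approx (c : R) (n : nat) (u : X) : X := res c (kato_source c n u).

Definition kato_resolvent (c : R) (u : X) : X :=
  limn (fun n => kato_approx c n u).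

Lemma has_gen_dom x y : has_gen U x y -> dom (generator U) x /\ generator U x = y.
Proof. by move=> /graph_generatorP[/= dx ->]. Qed.

Lemma perturbed_dissipative x y : has_gen U x y -> cone x -> Psi (y + B x) <= 0.
Proof. by move=> /has_gen_dom[dx <-]; exact: hAB. Qed.

Lemma resolvent_dom c u : 0 < c -> dom (generator U) (res c u).
Proof. by move=> c0; have [] := has_gen_dom (has_gen_resolvent hX hU (u := u) c0). Qed.

Section FixedParameter.
Variable c : R.
Hypothesis c0 : 0 < c.

Let lres : linear (res c) := resolvent_linear hX hU c0.
Let cres u : cone u -> cone (res c u).
Proof.
by move=> cu; apply: (resolvent_pos hX hU c0 cu); exact: (has_gen_resolvent hX hU c0).
Qed.

Lemma kato_jump_linear : linear (kato_jump c).
Proof. by move=> a u v; rewrite /kato_jump lres hBlin//; exact: (resolvent_dom c0). Qed.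

Lemma kato_jump_pos u : cone u -> cone (kato_jump c u).
Proof. by move=> cu; apply: hBpos; [exact: (resolvent_dom c0)|exact: cres]. Qed.

(** Dissipativity of [A + B] at [res c u], where its value is [c R u - u + J u]; all three terms
    are, up to sign, in the cone, on which [Psi] is the norm. *)
Lemma kato_jump_norm u : cone u -> c * `|res c u| + `|kato_jump c u| <= `|u|.
Proof.
move=> cu; have gu := @has_gen_resolvent _ _ _ hX _ hU c u c0.
have := perturbed_dissipative gu (cres cu); rewrite -/(kato_jump c u).
rewrite psiD psiB psiZ.
by rewrite !nPsi//; [lra|exact: kato_jump_pos|exact: cres].
Qed.

Lemma kato_jump_op : substoch_op cone (kato_jump c).
Proof.
split; [exact: kato_jump_linear|exact: kato_jump_pos|move=> u cu].
have := kato_jump_norm cu; apply: le_trans.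
by rewrite lerDr mulr_ge0// ltW.
Qed.

Let lJ := kato_jump_linear.

Lemma kato_sourceS n u :
  kato_source c n.+1 u = kato_source c n u + iter n (kato_jump c) u.
Proof.
elim: n => [|n IH]; first by rewrite /= (linear_0 lJ) addr0 add0r.
by rewrite [in LHS]/= -/(kato_source c n.+1 u) {1}IH (linear_D lJ) addrA.
Qed.

Lemma kato_source_linear n : linear (kato_source c n).
Proof.
elim: n => [|n IH] a u v /=; first by rewrite scaler0 addr0.
by rewrite IH lJ; lmod R X.
Qed.

Lemma kato_approx_linear n : linear (kato_approx c n).
Proof. by move=> a u v; rewrite /kato_approx kato_source_linear lres. Qed.

Lemma kato_approx0 u : kato_approx c 0 u = 0.
Proof. by rewrite /kato_approx /= (linear_0 lres). Qed.

Lemma kato_approx_step n u :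
  kato_approx c n.+1 u = kato_approx c n u + res c (iter n (kato_jump c) u).
Proof. by rewrite /kato_approx kato_sourceS (linear_D lres). Qed.

Lemma kato_approx_perturbed n u :
  has_gen U (kato_approx c n u) (c *: kato_approx c n u - kato_source c n u) /\
  c *: kato_approx c n u - kato_source c n u + B (kato_approx c n u) =
  c *: kato_approx c n u - u + iter n (kato_jump c) u.
Proof.
split; first exact: (has_gen_resolvent hX hU c0).
have -> : B (kato_approx c n u) =
    kato_source c n u + iter n (kato_jump c) u - u.
  by rewrite -kato_sourceS /= addrC addKr.
by lmod R X.
Qed.

Lemma iter_jump_pos n u : cone u -> cone (iter n (kato_jump c) u).
Proof. exact: substoch_op_pos (substoch_op_iter n kato_jump_op). Qed.

Lemma kato_approx_incr n u : cone u ->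
  cone (kato_approx c n.+1 u - kato_approx c n u).
Proof.
move=> cu; rewrite kato_approx_step addrAC subrr add0r.
by apply: cres; exact: iter_jump_pos.
Qed.

Lemma kato_approx_pos n u : cone u -> cone (kato_approx c n u).
Proof.
move=> cu; elim: n => [|n IH]; first by rewrite kato_approx0; exact: cone0 hX.
have := coneD hX (kato_approx_incr n cu) IH; by rewrite subrK.
Qed.

(** Dissipativity of [A + B] at [v_n]. The bound on [v_n] does not depend on [n], which makes the
    increasing sequence converge. *)
Lemma kato_approx_norm n u : cone u ->
  c * `|kato_approx c n u| + `|iter n (kato_jump c) u| <= `|u|.
Proof.
move=> cu; have [g e] := kato_approx_perturbed n u.
have := perturbed_dissipative g (kato_approx_pos n cu); rewrite e.
rewrite psiD psiB psiZ.
by rewrite !nPsi//; [lra|exact: iter_jump_pos|exact: kato_approx_pos].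
Qed.

Lemma kato_approx_op n : substoch_op cone (fun u => c *: kato_approx c n u).
Proof.
split=> [a u v|u cu|u cu].
- by rewrite kato_approx_linear; lmod R X.
- by apply: (coneZ hX); [exact: ltW|exact: kato_approx_pos].
- rewrite normrZ gtr0_norm//; apply: le_trans (kato_approx_norm n cu).
  by rewrite lerDl.
Qed.

End FixedParameter.

(** By additivity on the cone the norm of an increment is the increment of the norms, and these form
    a bounded monotone real sequence. *)
Lemma cone_monotone_cvg (v : nat -> X) (C : R) :
  (forall n, cone (v n)) -> (forall n, cone (v n.+1 - v n)) ->
  (forall n, `|v n| <= C) -> exists l : X, v @ \oo --> l.
Proof.
move=> cv iv vC; apply: cauchy_dist_cvgn => e e0.
have iv' n k : cone (v (n + k)%N - v n).
  elim: k => [|k IH]; first by rewrite addn0 subrr; exact: cone0 hX.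
  by rewrite addnS; exact: (cone_trans hX) IH (iv _).
have nd : nondecreasing_seq (fun n => `|v n|).
  move=> n m nm; rewrite -(subnKC nm).
  exact: (cone_norm_le hX (cv n) (iv' n _)).
have cn : cvgn (fun n => `|v n|).
  by apply: nondecreasing_is_cvgn => //; exists C => _ [n _ <-].
have [N _ NP] := (cvgrPdist_le _ _ (FF := _)).1 cn (e / 2) ltac:(lra).
exists N => n m Nn nm; rewrite distrC -(subnKC nm).
rewrite (cone_normB hX)//.
have := NP n Nn; have := NP (n + (m - n))%N (leq_trans Nn (leq_addr _ _)).
rewrite /= !ler_norml => /andP[a1 a2] /andP[b1 b2]; lra.
Qed.

Lemma kato_cvg (c : R) u : 0 < c ->
  (fun n => kato_approx c n u) @ \oo --> kato_resolvent c u.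
Proof.
move=> c0; suff [l ul] : exists l : X, (fun n => kato_approx c n u) @ \oo --> l.
  by apply/cvg_ex; exists l.
have cvg_pos v : cone v -> exists l : X, (fun n => kato_approx c n v) @ \oo --> l.
  move=> cv; apply: (@cone_monotone_cvg _ (`|v| / c)) => n.
  - exact: kato_approx_pos.
  - exact: kato_approx_incr.
  - rewrite ler_pdivlMr// mulrC; apply: le_trans (kato_approx_norm c0 n cv).
    by rewrite lerDl.
have [p [q [cp cq ->]]] := cone_generating hX u.
have [lp pl] := cvg_pos p cp; have [lq ql] := cvg_pos q cq.
exists (lp - lq).
have -> : (fun n => kato_approx c n (p - q)) =
    fun n => kato_approx c n p - kato_approx c n q.
  by apply/funext => n; rewrite (linear_B (kato_approx_linear c0 n)).
exact: cvgB.
Qed.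

Lemma kato_resolvent_op (c : R) : 0 < c ->
  substoch_op cone (fun u => c *: kato_resolvent c u).
Proof.
move=> c0; apply: (substoch_op_lim hX (kato_approx_op c0)) => u.
by apply: cvgZr; exact: kato_cvg.
Qed.

Lemma kato_resolvent_linear (c : R) : 0 < c -> linear (kato_resolvent c).
Proof.
move=> c0 a u v; have := substoch_op_lin (kato_resolvent_op c0) a u v.
rewrite scalerA (mulrC a) -scalerA -scalerDr => /(congr1 ( *:%R c^-1)).
by rewrite !scalerA mulVf ?gt_eqF// !scale1r.
Qed.

Lemma kato_approx_le (c : R) n u : 0 < c -> cone u ->
  cone (kato_resolvent c u - kato_approx c n u).
Proof.
move=> c0 cu.
have lim : (fun k => kato_approx c (k + n)%N u - kato_approx c n u) @ \oo -->
    kato_resolvent c u - kato_approx c n u.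
  apply: cvgB; last exact: cvg_cst.
  by have := @kato_cvg c u c0; rewrite -(cvg_shiftn n).
apply: (cone_lim hX _ lim) => k.
elim: k => [|k IH]; first by rewrite add0n subrr; exact: cone0 hX.
by rewrite addSn; exact: (cone_trans hX) IH (kato_approx_incr c0 _ cu).
Qed.

End Kato.

(** * Comparison of the iterations for two parameters, and the resolvent identity *)

Section KatoIdentities.
Context {R : realType} {X : completeNormedModType R}.
Variables (cone : set X) (Psi : X -> R) (U : R -> X -> X) (B : X -> X).
Hypothesis hX : abstract_state_space cone.
Hypothesis hPsi : norm_functional cone Psi.
Hypothesis hU : substochastic cone U.
Hypothesis hBlin : linear_on (dom (generator U)) B.
Hypothesis hBpos : positive_on cone (dom (generator U)) B.
Hypothesis hAB : forall u, dom (generator U) u -> cone u ->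
  Psi (generator U u + B u) <= 0.
Local Notation dnorm := (dnorm cone).
Local Notation res := (resolvent (generator U)).
Local Notation jump := (kato_jump U B).
Local Notation source := (kato_source U B).
Local Notation approx := (kato_approx U B).
Local Notation F := (kato_resolvent U B).

Lemma perturbationB x x' y y' : has_gen U x y -> has_gen U x' y' ->
  [/\ has_gen U (x - x') (y - y'), B (x - x') = B x - B x' &
      cone (x - x') -> cone (B x - B x')].
Proof.
move=> xy xy'; have [dx _] := has_gen_dom xy; have [dx' _] := has_gen_dom xy'.
have g : has_gen U (x - x') (y - y').
  have -> : x - x' = (-1) *: x' + x by lmod R X.
  have -> : y - y' = (-1) *: y' + y by lmod R X.
  by apply: has_gen_linear => //; apply: semigroup_linear; case: hU.
have e : B (x - x') = B x - B x'.
  have -> : x - x' = (-1) *: x' + x by lmod R X.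
  by rewrite hBlin//; lmod R X.
by split=> // cx; rewrite -e; apply: hBpos => //; have [] := has_gen_dom g.
Qed.

Lemma approx_gen (c : R) n u : 0 < c ->
  has_gen U (approx c n u) (c *: approx c n u - source c n u).
Proof. move=> c0; exact: (has_gen_resolvent hX hU c0). Qed.

(** The [m]-iterate is written as [res l] of [l - A] applied to it. The whole difference is then one
    value of the positive operator [res l], whose argument contains the difference of the preceding
    iterates: the shape required by induction. *)
Lemma approx_diff (l m : R) i j w u : 0 < l -> 0 < m ->
  approx l i.+1 w - approx m j.+1 u =
  res l (w - u - (l - m) *: approx m j.+1 u + (B (approx l i w) - B (approx m j u))).
Proof.
move=> l0 m0; have lres := resolvent_linear hX hU l0.
rewrite -[in LHS](resolventE hX hU l0 (approx_gen (n := j.+1) (u := u) m0)).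
rewrite {1}/kato_approx -(linear_B lres); congr (res l _).
rewrite /= -!/(jump _ _) /kato_jump -!/(approx _ _ _).
by lmod R X.
Qed.

Lemma approxB_pos (l m : R) i j w u : 0 < l -> 0 < m ->
  cone (approx l i w - approx m j u) ->
  cone (B (approx l i w) - B (approx m j u)).
Proof.
move=> l0 m0; have [_ _] := perturbationB
  (approx_gen (n := i) (u := w) l0) (approx_gen (n := j) (u := u) m0).
exact.
Qed.

Lemma res_pos (c : R) u : 0 < c -> cone u -> cone (res c u).
Proof.
move=> c0 cu; apply: (resolvent_pos hX hU c0 cu).
exact: (has_gen_resolvent hX hU c0).
Qed.

Lemma approx_mono (c : R) n k u : 0 < c -> cone u ->
  cone (approx c (k + n) u - approx c k u).
Proof.
move=> c0 cu; elim: n => [|n IH]; first by rewrite addn0 subrr; exact: cone0 hX.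
rewrite addnS; apply: (cone_trans hX) IH _.
exact: (kato_approx_incr hX hPsi hU hBlin hBpos hAB).
Qed.

Lemma approx_cvg (c : R) n (v : nat -> X) x : 0 < c -> v @ \oo --> x ->
  (fun k => approx c n (v k)) @ \oo --> approx c n x.
Proof.
move=> c0 vx.
have lim := substoch_op_cvg hX (kato_approx_op hX hPsi hU hBlin hBpos hAB c0 n) vx.
have cK w : approx c n w = c^-1 *: (c *: approx c n w).
  by rewrite scalerA mulVf ?gt_eqF// scale1r.
have -> : (fun k => approx c n (v k)) = (fun k => c^-1 *: (c *: approx c n (v k))).
  by apply/funext => k; exact: cK.
by rewrite [approx c n x]cK; exact: cvgZr.
Qed.

Let kcvg (c : R) u : 0 < c -> (fun n => approx c n u) @ \oo --> F c u.
Proof. by move=> c0; apply: (kato_cvg hX hPsi hU hBlin hBpos hAB). Qed.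

Let kle (c : R) n u : 0 < c -> cone u -> cone (F c u - approx c n u).
Proof. exact: (kato_approx_le hX hPsi hU hBlin hBpos hAB). Qed.

Let klin (c : R) : 0 < c -> linear (F c).
Proof. exact: (kato_resolvent_linear hX hPsi hU hBlin hBpos hAB). Qed.

(** The source contains the full limit [F m u], which exceeds each [approx m n.+1 u], so positivity
    propagates from step to step. *)
Lemma approx_ge (l m : R) n u : 0 < m -> m < l -> cone u ->
  cone (approx l n (u + (l - m) *: F m u) - approx m n u).
Proof.
move=> m0 ml cu; have l0 := lt_trans m0 ml; elim: n => [|n IH].
  by rewrite !(kato_approx0 B hX hU) ?subrr//; exact: cone0 hX.
rewrite approx_diff//; apply: res_pos => //; apply: (coneD hX).
  have -> : u + (l - m) *: F m u - u - (l - m) *: approx m n.+1 u =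
      (l - m) *: (F m u - approx m n.+1 u) by lmod R X.
  by apply: (coneZ hX); [lra|exact: kle].
exact: approxB_pos.
Qed.

(** For the reverse bound the source contains only the iterate of rank [k]; giving the [m]-iteration
    a lead of [k] steps keeps it above that iterate. *)
Lemma approx_le_shift (l m : R) n k u : 0 < m -> m < l -> cone u ->
  cone (approx m (k + n) u - approx l n (u + (l - m) *: approx m k u)).
Proof.
move=> m0 ml cu; have l0 := lt_trans m0 ml; elim: n => [|n IH].
  rewrite (kato_approx0 B hX hU)// subr0 addn0.
  exact: (kato_approx_pos hX hPsi hU hBlin hBpos hAB).
rewrite addnS.
set w := u + _.
have lres := resolvent_linear hX hU l0.
have -> : approx m (k + n).+1 u - approx l n.+1 w =
    res l ((l - m) *: (approx m (k + n).+1 u - approx m k u) +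
           (B (approx m (k + n) u) - B (approx l n w))).
  rewrite -[LHS]opprB approx_diff// -(linear_N lres); congr (res l _).
  by rewrite /w; lmod R X.
apply: res_pos => //; apply: (coneD hX); last exact: approxB_pos.
apply: (coneZ hX); first lra.
by rewrite -addnS; exact: approx_mono.
Qed.

(** Antisymmetry of the order applied to the two comparisons. In the shifted one [k] tends to
    infinity first, at fixed [n]. *)
Lemma kato_resolvent_identity_pos (l m : R) u : 0 < m -> m < l -> cone u ->
  F l (u + (l - m) *: F m u) = F m u.
Proof.
move=> m0 ml cu; have l0 := lt_trans m0 ml; apply: (cone_antisym hX).
  have lim : (fun n => F m u - approx l n (u + (l - m) *: F m u)) @ \oo -->
      F m u - F l (u + (l - m) *: F m u).
    by apply: cvgB; [exact: cvg_cst|exact: kcvg].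
  apply: (cone_lim hX _ lim) => n.
  have lim' : (fun k => approx m (k + n) u - approx l n (u + (l - m) *: approx m k u))
      @ \oo --> F m u - approx l n (u + (l - m) *: F m u).
    apply: cvgB; first by have := @kcvg m u m0; rewrite -(cvg_shiftn n).
    apply: approx_cvg => //; apply: cvgD; first exact: cvg_cst.
    by apply: cvgZr; exact: kcvg.
  by apply: (cone_lim hX _ lim') => k; exact: approx_le_shift.
have lim : (fun n => approx l n (u + (l - m) *: F m u) - approx m n u) @ \oo -->
    F l (u + (l - m) *: F m u) - F m u by apply: cvgB; exact: kcvg.
by apply: (cone_lim hX _ lim) => n; exact: approx_ge.
Qed.

Lemma kato_resolvent_identity_lt (l m : R) u : 0 < m -> m < l ->
  F l (u + (l - m) *: F m u) = F m u.
Proof.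
move=> m0 ml; have l0 := lt_trans m0 ml.
have [p [q [cp cq ->]]] := cone_generating hX u.
rewrite (linear_B (klin m0)).
rewrite -{2}(kato_resolvent_identity_pos m0 ml cp).
rewrite -{2}(kato_resolvent_identity_pos m0 ml cq).
by rewrite -(linear_B (klin l0)); congr (F l _); lmod R X.
Qed.

Lemma kato_resolvent_identity (l m : R) u : 0 < l -> 0 < m ->
  F l (u + (l - m) *: F m u) = F m u.
Proof.
move=> l0 m0; have [ml|lm|->] := ltgtP m l; first exact: kato_resolvent_identity_lt.
  set y := F l _.
  have yE := kato_resolvent_identity_lt (u + (l - m) *: F m u) l0 lm.
  rewrite -/y in yE.
  have opm := kato_resolvent_op hX hPsi hU hBlin hBpos hAB m0.
  apply/eqP; rewrite -subr_eq0; apply/eqP.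
  (* The known case with the parameters exchanged shows that [z = y - F m u] satisfies
     [z = (m - l) F m z]; since [m F m] contracts [dnorm] and [(m - l) / m < 1], [z] vanishes. *)
  apply: (neumann_inj hX (q := (m - l) / m) opm); first by rewrite divr_ge0//; lra.
    by rewrite ltr_pdivrMr//; lra.
  rewrite scalerA divfK ?gt_eqF// (linear_B (klin m0)).
  rewrite -{1}yE !(linear_D (klin m0)) !(linear_Z (klin m0)).
  by lmod R X.
by rewrite subrr scale0r addr0.
Qed.

(** With [f = (c - A) x] one has [B x = J f], so the source of [f - J f] telescopes to [f - J^n f],
    and [res c (J^n f)] is an increment of a convergent sequence. *)
Lemma kato_resolvent_perturbed (c : R) x y : 0 < c -> has_gen U x y ->
  F c (c *: x - y - B x) = x.
Proof.
move=> c0 xy; set f := c *: x - y.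
have fx : res c f = x by exact: (resolventE hX hU c0).
have lJ := kato_jump_linear hX hU hBlin c0.
have lres := resolvent_linear hX hU c0.
have srcE n : source c n (f - B x) = f - iter n (jump c) f.
  elim: n => [|n IH]; first by rewrite /= subrr.
  by rewrite /= IH (linear_B lJ) {1}/kato_jump fx; lmod R X.
have aE n : approx c n (f - B x) = x - (approx c n.+1 f - approx c n f).
  have -> : approx c n.+1 f - approx c n f = res c (iter n (jump c) f).
    by rewrite (kato_approx_step hX hU hBlin c0) addrAC subrr add0r.
  by rewrite /kato_approx srcE (linear_B lres) fx.
apply: (cvg_unique (@norm_hausdorff _ _) (kcvg c0)).
have lim : (fun n => x - (approx c n.+1 f - approx c n f)) @ \oo -->
    x - (F c f - F c f).
  apply: cvgB; first exact: cvg_cst.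
  apply: cvgB; last exact: kcvg.
  by rewrite (cvg_shiftS (fun n => approx c n f)); exact: kcvg.
rewrite subrr subr0 in lim.
by have -> : (fun n => approx c n (f - B x)) =
    (fun n => x - (approx c n.+1 f - approx c n f)) by apply/funext.
Qed.

(** For [p] in the cone, [c R p <= c F p] and the norm of [c F p] is at most that of [p]. By
    additivity [c F p - c R p] is therefore no longer than [p - c R p], which is small for the
    unperturbed resolvent. *)
Lemma kato_resolvent_approx (u : X) (e : R) : 0 < e ->
  exists2 L, 0 < L & forall c, L <= c -> dnorm (c *: F c u - u) <= e.
Proof.
move=> e0.
have app_pos p : cone p -> exists2 L, 0 < L &
    forall c, L <= c -> dnorm (c *: F c p - p) <= e / 2.
  move=> cp.
  have [L L0 LP] := resolvent_approx hX hU hPsi p (e := e / 4) ltac:(lra).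
  exists L => // c Lc; have c0 := lt_le_trans L0 Lc; have := LP c Lc.
  set r := c *: res c p => rp.
  have cr : cone r by apply: (coneZ hX); [exact: ltW|exact: res_pos].
  have rF : cone (c *: F c p - r).
    rewrite -scalerBr; apply: (coneZ hX); first exact: ltW.
    have := kle 1 c0 cp; rewrite /kato_approx (kato_sourceS hX hU hBlin c0).
    by rewrite add0r.
  have nF : `|c *: F c p| <= `|p|.
    by have [_ _] := kato_resolvent_op hX hPsi hU hBlin hBpos hAB c0; apply.
  have Fr : dnorm (c *: F c p - r) <= e / 4.
    rewrite dnorm_cone// (cone_normB hX)//.
    have := norm_le_dnorm hX (r - p).
    have := ler_normB r (r - p).
    have -> : r - (r - p) = p by lmod R X.
    lra.
  have -> : c *: F c p - p = (c *: F c p - r) + (r - p) by lmod R X.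
  have := dnormD hX (c *: F c p - r) (r - p); lra.
have [p [q [cp cq ->]]] := cone_generating hX u.
have [Lp Lp0 LpP] := app_pos p cp; have [Lq Lq0 LqP] := app_pos q cq.
exists (Lp + Lq); first lra.
move=> c Lc.
have c0 : 0 < c by lra.
have -> : c *: F c (p - q) - (p - q) = (c *: F c p - p) - (c *: F c q - q).
  by rewrite (linear_B (klin c0)); lmod R X.
have := dnormB hX (c *: F c p - p) (c *: F c q - q).
have := LpP c ltac:(lra); have := LqP c ltac:(lra); lra.
Qed.

End KatoIdentities.

(** * The semigroup of a substochastic resolvent, by implicit Euler steps *)

Section HilleYosida.
Context {R : realType} {X : completeNormedModType R}.
Variables (cone : set X) (F : R -> X -> X).
Hypothesis hX : abstract_state_space cone.
Hypothesis Fop : forall c : R, 0 < c -> substoch_op cone (fun u => c *: F c u).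
Hypothesis Fid : forall (l m : R) u, 0 < l -> 0 < m ->
  F l (u + (l - m) *: F m u) = F m u.
Hypothesis Fapprox : forall u (e : R), 0 < e ->
  exists2 c, 0 < c & dnorm cone (c *: F c u - u) <= e.
Local Notation dnorm := (dnorm cone).

(* [E a] is [(1 - a H)^-1] for the generator [H] with resolvent [F]. *)
Definition euler (a : R) (u : X) : X := if a == 0 then u else a^-1 *: F a^-1 u.
Local Notation E := euler.

Lemma euler_op (a : R) : 0 <= a -> substoch_op cone (E a).
Proof.
rewrite le_eqVlt eq_sym /euler => /predU1P[->|a0].
  by rewrite eqxx; exact: substoch_op_id.
by rewrite gt_eqF//; apply: Fop; rewrite invr_gt0.
Qed.

Let lE (a : R) : 0 <= a -> linear (E a).
Proof. by move=> a0; exact: substoch_op_lin (euler_op a0). Qed.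

Let lF (c : R) : 0 < c -> linear (F c).
Proof.
move=> c0 a u v; have := substoch_op_lin (Fop c0) a u v.
rewrite scalerA (mulrC a) -scalerA -scalerDr => /(congr1 ( *:%R c^-1)).
by rewrite !scalerA mulVf ?gt_eqF// !scale1r.
Qed.

Lemma resolvent_commute (l m : R) u : 0 < l -> 0 < m -> F l (F m u) = F m (F l u).
Proof.
move=> l0 m0; have [->//|lm] := eqVneq l m.
have := Fid u l0 m0; have := Fid u m0 l0.
rewrite (linear_D (lF l0)) (linear_Z (lF l0)) (linear_D (lF m0)) (linear_Z (lF m0)).
move=> e1 e2.
have lm0 : l - m != 0 by rewrite subr_eq0.
have -> : F l (F m u) = (l - m)^-1 *: (F m u - F l u).
  by rewrite -[X in _ *: (X - _)]e2; lmod R X.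
by rewrite -[X in _ *: (_ - X)]e1; lmod R X.
Qed.

Lemma euler_commute (a b : R) u : 0 <= a -> 0 <= b -> E a (E b u) = E b (E a u).
Proof.
rewrite !le_eqVlt ![0 == _]eq_sym /euler => /predU1P[->|a0]; first by rewrite eqxx.
move=> /predU1P[->|b0]; first by rewrite eqxx.
have ia : 0 < a^-1 by rewrite invr_gt0.
have ib : 0 < b^-1 by rewrite invr_gt0.
rewrite !gt_eqF// (linear_Z (lF ia)) (linear_Z (lF ib)) resolvent_commute//.
by lmod R X; rewrite !gt_eqF.
Qed.

(** The graph of [H], expressed by resolvents because there is no semigroup to differentiate yet.
    Asking for all [a] at once allows the step size to change freely. *)
Definition euler_gen (x y : X) : Prop :=
  forall a : R, 0 <= a -> E a (x - a *: y) = x.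
Local Notation H := euler_gen.

Lemma euler_gen_resolvent (c : R) u : 0 < c -> H (F c u) (c *: F c u - u).
Proof.
move=> c0 a; rewrite le_eqVlt eq_sym /euler => /predU1P[->|a0].
  by rewrite eqxx scale0r subr0.
have ia : 0 < a^-1 by rewrite invr_gt0.
rewrite gt_eqF// -(linear_Z (lF ia)) -[RHS](Fid u ia c0); congr (F _ _).
by lmod R X; rewrite gt_eqF.
Qed.

Lemma euler_genB x y x' y' : H x y -> H x' y' -> H (x - x') (y - y').
Proof.
move=> xy xy' a a0; rewrite -[X in _ = X - _](xy a a0) -[X in _ = _ - X](xy' a a0).
by rewrite -(linear_B (lE a0)); congr (E _ _); lmod R X.
Qed.

Lemma euler_genZ (k : R) x y : H x y -> H (k *: x) (k *: y).
Proof.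
move=> xy a a0; rewrite -[X in _ = _ *: X](xy a a0).
by rewrite -(linear_Z (lE a0)); congr (E _ _); lmod R X.
Qed.

Lemma euler_gen_step (a : R) x y : 0 <= a -> H x y -> E a x - x = a *: E a y.
Proof.
move=> a0 xy; have la := lE a0.
by rewrite -{2}(xy a a0) (linear_B la) (linear_Z la); lmod R X.
Qed.

(** Since [(1 - a H)(1 - b H) = 1 - (a + b) H + a b H^2], the inverses differ by a term of second
    order in the steps. *)
Lemma euler_splitting (a b : R) x y z : 0 <= a -> 0 <= b -> H x y -> H y z ->
  E (a + b) x - E a (E b x) = (a * b) *: E (a + b) (E a (E b z)).
Proof.
move=> a0 b0 xy yz; have ab0 := addr_ge0 a0 b0.
have la := lE a0; have lb := lE b0; have lab := lE ab0.
have e1 : E a (E b (x - (a + b) *: y + (a * b) *: z)) = x.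
  have -> : x - (a + b) *: y + (a * b) *: z =
      (x - b *: y) - a *: (y - b *: z) by lmod R X.
  by rewrite (linear_B lb) (linear_Z lb) xy// yz// xy.
rewrite -{1}e1 (linear_D lb) (linear_D la) (linear_D lab).
rewrite (linear_Z lb) (linear_Z la) (linear_Z lab).
rewrite (euler_commute _ ab0 a0) (euler_commute _ ab0 b0) xy//.
by rewrite addrAC subrr add0r.
Qed.

(** The domain of the square of [H], on which the splitting error is controlled. *)
Definition euler_core : set X := [set x | exists y z, H x y /\ H y z].

Lemma euler_core_dense u (e : R) : 0 < e ->
  exists2 x, euler_core x & dnorm (u - x) <= e.
Proof.
move=> e0; have [c c0 cu] := Fapprox u (e := e / 2) ltac:(lra).
exists (c *: F c (c *: F c u)); last first.
  have op := Fop c0.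
  have := substoch_op_dnorm hX (u - c *: F c u) op.
  have := dnormD hX (u - c *: F c u) (c *: F c (u - c *: F c u)).
  rewrite -(dnormN hX) opprB in cu.
  have -> : u - c *: F c u + c *: F c (u - c *: F c u) = u - c *: F c (c *: F c u).
    by rewrite (linear_B (lF c0)); lmod R X.
  lra.
have gZ v : H (c *: F c v) (c *: (c *: F c v - v)).
  by apply: euler_genZ; exact: euler_gen_resolvent.
set p := c *: F c u; set x := c *: F c p.
exists (c *: (x - p)), (c *: (c *: (x - p) - c *: (p - u))).
by split; [exact: gZ|apply: euler_genZ; apply: euler_genB; exact: gZ].
Qed.

Lemma iter_dist (P Q : X -> X) n x : substoch_op cone P -> substoch_op cone Q ->
  (forall u, P (Q u) = Q (P u)) ->
  dnorm (iter n P x - iter n Q x) <= n%:R * dnorm (P x - Q x).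
Proof.
move=> hP hQ PQ; have lP := substoch_op_lin hP.
have PiQ k u : P (iter k Q u) = iter k Q (P u).
  by elim: k => //= k IH; rewrite PQ IH.
elim: n => [|n IH]; first by rewrite /= subrr (dnorm0 hX) mul0r.
have lQ := substoch_op_lin (substoch_op_iter n hQ).
have -> : iter n.+1 P x - iter n.+1 Q x =
    P (iter n P x - iter n Q x) + iter n Q (P x - Q x).
  rewrite (linear_B lP) (linear_B lQ) PiQ -iterSr /=.
  by lmod R X.
rewrite (le_trans (dnormD hX _ _))// -natr1 mulrDl mul1r lerD//.
  by rewrite (le_trans (substoch_op_dnorm hX _ hP)).
exact: (substoch_op_dnorm hX _ (substoch_op_iter n hQ)).
Qed.

(** Powers of two make each refinement replace [E (2 h)] by [E h] applied twice, the case [a = b] of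
    the splitting formula. *)
Definition euler_approx (t : R) (m : nat) : X -> X :=
  iter (2 ^ m) (E (t / 2 ^+ m)).

Section FixedTime.
Variable t : R.
Hypothesis t0 : 0 <= t.

Let h_ge0 m : 0 <= t / 2 ^+ m.
Proof. by rewrite divr_ge0// exprn_ge0. Qed.

Let nh m : (2 ^ m)%:R * (t / 2 ^+ m) = t.
Proof. by rewrite natrX mulrC divfK// expf_neq0. Qed.

Lemma euler_approx_op m : substoch_op cone (euler_approx t m).
Proof. by apply: substoch_op_iter; exact: euler_op. Qed.

(** The [2 ^ m] coarse steps are replaced one by one, each at cost [h^2 dnorm z] with
    [h = t / 2^(m+1)]. The total is a quarter of the stated bound. *)
Lemma euler_approx_step m x y z : H x y -> H y z ->
  dnorm (euler_approx t m.+1 x - euler_approx t m x) <=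
  (t ^+ 2 * dnorm z) * 2^-1 ^+ m.
Proof.
move=> xy yz; rewrite -(dnormN hX) opprB /euler_approx.
pose h := t / 2 ^+ m.+1.
have h0 : 0 <= h := h_ge0 m.+1.
have hh : t / 2 ^+ m = h + h by rewrite /h exprS; field; rewrite expf_neq0.
have -> : iter (2 ^ m.+1) (E (t / 2 ^+ m.+1)) x = iter (2 ^ m) (E h \o E h) x.
  rewrite expnS mulnC -/h iterM.
  by elim: (2 ^ m)%N => //= n ->.
rewrite hh.
have ops : substoch_op cone (E h \o E h).
  by apply: substoch_op_comp; exact: euler_op.
have cm u : E (h + h) ((E h \o E h) u) = (E h \o E h) (E (h + h) u).
  by rewrite /= !(euler_commute _ (addr_ge0 h0 h0) h0).
rewrite (le_trans (iter_dist _ _ (euler_op (addr_ge0 h0 h0)) ops cm))//=.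
rewrite (euler_splitting h0 h0 xy yz).
have opz := substoch_op_dnorm hX z (substoch_op_comp (euler_op (addr_ge0 h0 h0)) ops).
have bound : dnorm ((h * h) *: E (h + h) (E h (E h z))) <= h * h * dnorm z.
  rewrite (le_trans (dnormZ_ge0 hX _ (mulr_ge0 h0 h0)))// ler_wpM2l//.
  exact: mulr_ge0.
rewrite (le_trans (ler_wpM2l (ler0n _ _) bound))//.
have -> : (2 ^ m)%:R * (h * h * dnorm z) = t ^+ 2 * dnorm z * 2^-1 ^+ m / 4.
  rewrite /h exprVn natrX exprS; field; rewrite expf_neq0//.
rewrite ler_pdivrMr// ler_peMr//; last lra.
by rewrite !mulr_ge0 ?exprn_ge0 ?dnorm_ge0.
Qed.

Lemma euler_approx_cvg u : exists l : X, (fun m => euler_approx t m u) @ \oo --> l.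
Proof.
apply: (substoch_ops_cvg hX euler_approx_op euler_core_dense) => x [y [z [xy yz]]].
apply: (@cvgn_geometric_steps _ _ _ (t ^+ 2 * dnorm z) 2^-1) => [||m]; [lra|lra|].
exact: le_trans (norm_le_dnorm hX _) (euler_approx_step m xy yz).
Qed.

Lemma euler_iter_near k m x y : (k <= 2 ^ m)%N -> H x y ->
  dnorm (iter k (E (t / 2 ^+ m)) x - x) <= t * dnorm y.
Proof.
move=> km xy; have opE := euler_op (h_ge0 m).
have id_iter : iter k id x = x by elim: k {km} => //= k ->.
rewrite -{2}id_iter.
rewrite (le_trans (iter_dist _ _ opE (substoch_op_id _) (fun=> erefl)))//.
rewrite (euler_gen_step (h_ge0 m) xy).
have -> : t * dnorm y = (2 ^ m)%:R * (t / 2 ^+ m * dnorm y) by rewrite mulrA nh.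
apply: ler_pM; rewrite ?dnorm_ge0 ?ler_nat//.
rewrite (le_trans (dnormZ_ge0 hX _ (h_ge0 m)))// ler_wpM2l//.
exact: (substoch_op_dnorm hX).
Qed.

Lemma euler_iter_near_dense k m u x y : (k <= 2 ^ m)%N -> H x y ->
  dnorm (iter k (E (t / 2 ^+ m)) u - u) <= 2 * dnorm (u - x) + t * dnorm y.
Proof.
move=> km xy; have opE := substoch_op_iter k (euler_op (h_ge0 m)).
set P := iter k _ in opE *.
have -> : P u - u = (P (u - x) - (u - x)) + (P x - x).
  by rewrite (linear_B (substoch_op_lin opE)); lmod R X.
have := dnormD hX (P (u - x) - (u - x)) (P x - x).
have := dnormB hX (P (u - x)) (u - x).
have := substoch_op_dnorm hX (u - x) opE.
have := euler_iter_near km xy; rewrite -/P; lra.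
Qed.

(* Telescoping [E^N x - x] leaves a mean of the vectors [E^k y], which are all
   close to [y]. *)
Lemma euler_approx_gen m x y y' z' : H x y -> H y' z' ->
  dnorm (euler_approx t m x - x - t *: y) <=
  t * (2 * dnorm (y - y') + t * dnorm z').
Proof.
move=> xy yz; set h := t / 2 ^+ m; have h0 : 0 <= h := h_ge0 m.
have opE := euler_op h0.
pose g k := h *: (iter k.+1 (E h) y - y).
have sumE n : iter n (E h) x - x - (n%:R * h) *: y = \sum_(0 <= k < n) g k.
  elim: n => [|n IH]; first by rewrite big_geq// mul0r scale0r subr0 subrr.
  rewrite sum_nat_recr -IH /g.
  have -> : iter n.+1 (E h) x = iter n (E h) x + h *: iter n.+1 (E h) y.
    rewrite !iterSr -(linear_Z (substoch_op_lin (substoch_op_iter n opE))).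
    rewrite -(linear_D (substoch_op_lin (substoch_op_iter n opE))).
    by rewrite -(euler_gen_step h0 xy) addrC subrK.
  by rewrite -natr1; lmod R X.
have -> : euler_approx t m x - x - t *: y = \sum_(0 <= k < 2 ^ m) g k.
  by rewrite -sumE nh.
set C := 2 * _ + _; have -> : t * C = (2 ^ m)%:R * (h * C) by rewrite mulrA nh.
apply: (dnorm_sum_le hX) => k km.
rewrite (le_trans (dnormZ_ge0 hX _ h0))// ler_wpM2l//.
exact: euler_iter_near_dense.
Qed.

End FixedTime.

Definition euler_semigroup (t : R) (u : X) : X :=
  limn (fun m => euler_approx t m u).
Local Notation W := euler_semigroup.

Let Wcvg (t : R) u : 0 <= t -> (fun m => euler_approx t m u) @ \oo --> W t u.
Proof. by move=> t0; have [l ul] := euler_approx_cvg t0 u; apply/cvg_ex; exists l. Qed.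

Lemma euler_semigroup_op (t : R) : 0 <= t -> substoch_op cone (W t).
Proof.
move=> t0; apply: (substoch_op_lim hX (euler_approx_op t0)) => u.
exact: Wcvg.
Qed.

Lemma dnorm_lim_le (v : nat -> X) l (C : R) : v @ \oo --> l ->
  (forall n, dnorm (v n) <= C) -> dnorm l <= C.
Proof.
move=> vl vC; apply/ler_addgt0Pr => e e0.
have [N NP] := cvgn_dnorm hX vl e0.
have -> : l = v N - (v N - l) by lmod R X.
by rewrite (le_trans (dnormB hX _ _))// lerD// NP.
Qed.

Lemma euler_semigroup_near (t : R) u x y : 0 <= t -> H x y ->
  dnorm (W t u - u) <= 2 * dnorm (u - x) + t * dnorm y.
Proof.
move=> t0 xy.
have lim : (fun m => euler_approx t m u - u) @ \oo --> W t u - u.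
  by apply: cvgB; [exact: Wcvg|exact: cvg_cst].
by apply: (dnorm_lim_le lim) => m; exact: euler_iter_near_dense.
Qed.

Lemma euler_semigroup_gen x y : H x y -> has_gen W x y.
Proof.
move=> xy; apply/has_genP => e e0.
(* [y] need not lie in the domain of [H], so a nearby [y'] that does is used: the relative error is
   at most [2 (e / 4) + t dnorm z'], and [t] is taken small enough for the last term. *)
have [y' [z' [_ [yz _]]] yy'] := euler_core_dense y (e := e / 4) ltac:(lra).
have z0 : 0 < dnorm z' + 1 by have := dnorm_ge0 hX z'; lra.
exists (e / 2 / (dnorm z' + 1)); first by rewrite divr_gt0//; lra.
move=> t t0 td; have t0' := ltW t0.
have lim : (fun m => euler_approx t m x - x - t *: y) @ \oo --> W t x - x - t *: y.
  apply: cvgB; last exact: cvg_cst.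
  by apply: cvgB; [exact: Wcvg|exact: cvg_cst].
rewrite (le_trans (norm_le_dnorm hX _))//.
apply: (dnorm_lim_le lim) => m.
rewrite (le_trans (euler_approx_gen t0' m xy yz))// mulrC ler_wpM2r//.
move: td; rewrite ltr_pdivlMr// => td.
have : t * dnorm z' <= t * (dnorm z' + 1) by rewrite ler_wpM2l//; lra.
lra.
Qed.

(** On the core, [2 ^ m] steps [E (a + b)] and as many steps [E a] after [E b], with [a = s / 2^m]
    and [b = t / 2^m], differ by at most [s t dnorm z / 2^m]. Density and contraction give the
    rest. *)
Lemma euler_semigroupD (s t : R) u : 0 <= s -> 0 <= t -> W (s + t) u = W s (W t u).
Proof.
move=> s0 t0; have st0 := addr_ge0 s0 t0.
have opst := euler_semigroup_op st0.
have ops := euler_semigroup_op s0; have opt := euler_semigroup_op t0.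
have core x : euler_core x -> W (s + t) x = W s (W t x).
  move=> [y [z [xy yz]]].
  have lim1 : (fun m => euler_approx s m (euler_approx t m x)) @ \oo --> W s (W t x).
    apply: (dnorm_cvgn hX) => e e0.
    have [N1 N1P] := cvgn_dnorm hX (@Wcvg t x t0) (e := e / 2) ltac:(lra).
    have [N2 N2P] := cvgn_dnorm hX (@Wcvg s (W t x) s0) (e := e / 2) ltac:(lra).
    exists (maxn N1 N2) => m; rewrite geq_max => /andP[m1 m2].
    have opm := euler_approx_op s0 m.
    have -> : euler_approx s m (euler_approx t m x) - W s (W t x) =
        euler_approx s m (euler_approx t m x - W t x) +
        (euler_approx s m (W t x) - W s (W t x)).
      by rewrite (linear_B (substoch_op_lin opm)); lmod R X.
    rewrite (le_trans (dnormD hX _ _))//.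
    have := substoch_op_dnorm hX (euler_approx t m x - W t x) opm.
    have := N1P m m1; have := N2P m m2; lra.
  have lim2 : (fun m => euler_approx (s + t) m x -
      euler_approx s m (euler_approx t m x)) @ \oo --> W (s + t) x - W s (W t x).
    by apply: cvgB => //; exact: Wcvg.
  apply/eqP; rewrite -subr_eq0; apply/eqP; apply: (cvg_unique (@norm_hausdorff _ _) lim2).
  apply: (dnorm_cvgn hX) => e e0.
  have [N NP] := geometric_small (s * t * dnorm z) (q := 2^-1) ltac:(lra) ltac:(lra) e0.
  exists N => m /NP; rewrite subr0; apply: le_trans.
  pose a := s / 2 ^+ m; pose b := t / 2 ^+ m.
  have a0 : 0 <= a by rewrite divr_ge0// exprn_ge0.
  have b0 : 0 <= b by rewrite divr_ge0// exprn_ge0.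
  have ab0 := addr_ge0 a0 b0.
  have -> : euler_approx s m (euler_approx t m x) = iter (2 ^ m) (E a \o E b) x.
    rewrite /euler_approx -/a -/b; elim: (2 ^ m)%N => //= n IH.
    have ci k v : iter k (E a) (E b v) = E b (iter k (E a) v).
      by elim: k => //= k ->; rewrite euler_commute.
    by rewrite ci IH.
  have -> : euler_approx (s + t) m x = iter (2 ^ m) (E (a + b)) x.
    by rewrite /euler_approx mulrDl.
  have opab : substoch_op cone (E a \o E b).
    by apply: substoch_op_comp; exact: euler_op.
  have cm v : E (a + b) ((E a \o E b) v) = (E a \o E b) (E (a + b) v).
    by rewrite /= (euler_commute _ ab0 a0) (euler_commute _ ab0 b0).
  rewrite (le_trans (iter_dist _ _ (euler_op ab0) opab cm))//=.
  rewrite (euler_splitting a0 b0 xy yz).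
  have opz := substoch_op_dnorm hX z (substoch_op_comp (euler_op ab0) opab).
  have bound : dnorm ((a * b) *: E (a + b) (E a (E b z))) <= a * b * dnorm z.
    rewrite (le_trans (dnormZ_ge0 hX _ (mulr_ge0 a0 b0)))// ler_wpM2l//.
    exact: mulr_ge0.
  rewrite (le_trans (ler_wpM2l (ler0n _ _) bound))//.
  rewrite le_eqVlt; apply/orP; left; apply/eqP.
  by rewrite /a /b exprVn natrX; field; rewrite expf_neq0.
apply/eqP; rewrite -subr_eq0; apply/eqP; apply: (dnorm_small hX) => e e0.
have [x cx ux] := euler_core_dense u (e := e / 2) ltac:(lra).
have -> : W (s + t) u - W s (W t u) = W (s + t) (u - x) - W s (W t (u - x)).
  rewrite (linear_B (substoch_op_lin opst)) (linear_B (substoch_op_lin opt)).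
  by rewrite (linear_B (substoch_op_lin ops)) (core x cx) opprB addrA subrK.
rewrite (le_trans (dnormB hX _ _))//.
have := substoch_op_dnorm hX (u - x) opst.
have := substoch_op_dnorm hX (u - x) (substoch_op_comp ops opt).
rewrite /=; lra.
Qed.

Lemma euler_semigroup_substochastic : substochastic cone W.
Proof.
split; [split| |].
- by move=> t t0; exact: substoch_op_lin (euler_semigroup_op t0).
- by move=> t t0; exact: substoch_op_continuous (euler_semigroup_op t0).
- move=> u; apply/esym/(cvg_unique (@norm_hausdorff _ _) _ (@Wcvg 0 u (lexx 0))).
  suff -> : (fun m => euler_approx 0 m u) = fun=> u by exact: cvg_cst.
  apply/funext => m; rewrite /euler_approx mul0r.
  by elim: (2 ^ m)%N => //= n ->; rewrite /euler eqxx.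
- by move=> s t s0 t0 u; exact: euler_semigroupD.
- move=> u; apply/cvg_at_right0P => e e0.
  have [x [y [z [xy _]]] ux] := euler_core_dense u (e := e / 4) ltac:(lra).
  have y0 : 0 < dnorm y + 1 by have := dnorm_ge0 hX y; lra.
  exists (e / 2 / (dnorm y + 1)); first by rewrite divr_gt0//; lra.
  move=> t t0 td; rewrite (le_trans (norm_le_dnorm hX _))//.
  rewrite (le_trans (euler_semigroup_near u (ltW t0) xy))//.
  move: td; rewrite ltr_pdivlMr// => td.
  have : t * dnorm y <= t * (dnorm y + 1) by rewrite ler_wpM2l//; lra.
  lra.
- by move=> t u t0; exact: substoch_op_pos (euler_semigroup_op t0).
- by move=> t u t0 cu; have [_ _] := euler_semigroup_op t0; apply.
Qed.

Lemma euler_semigroup_resolvent (c : R) u : 0 < c ->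
  has_gen W (F c u) (c *: F c u - u).
Proof. by move=> c0; apply: euler_semigroup_gen; exact: euler_gen_resolvent. Qed.

End HilleYosida.

(** * The mass lost in the limit *)

Section Loss.
Context {R : realType} {X : completeNormedModType R}.
Variables (cone : set X) (Psi : X -> R) (U : R -> X -> X) (B : X -> X).
Hypothesis hX : abstract_state_space cone.
Hypothesis hPsi : norm_functional cone Psi.
Hypothesis hU : substochastic cone U.
Hypothesis hBlin : linear_on (dom (generator U)) B.
Hypothesis hBpos : positive_on cone (dom (generator U)) B.
Hypothesis hAB : forall u, dom (generator U) u -> cone u ->
  Psi (generator U u + B u) <= 0.
Local Notation dnorm := (dnorm cone).
Local Notation res := (resolvent (generator U)).
Local Notation jump := (kato_jump U B).
Local Notation source := (kato_source U B).
Local Notation approx := (kato_approx U B).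
Local Notation F := (kato_resolvent U B).

Let psiD := functional_D hPsi.
Let psiB := functional_B hPsi.
Let psiZ := functional_Z hPsi.
Let nPsi u : cone u -> Psi u = `|u| := functional_norm hPsi (u := u).

Let opJ (c : R) : 0 < c -> substoch_op cone (jump c).
Proof. exact: (kato_jump_op hX hPsi hU hBlin hBpos hAB). Qed.

Let kcvg (c : R) u : 0 < c -> (fun n => approx c n u) @ \oo --> F c u.
Proof. by move=> c0; apply: (kato_cvg hX hPsi hU hBlin hBpos hAB). Qed.

Lemma functional_le_dnorm u : `|Psi u| <= dnorm u.
Proof.
apply/ler_addgt0Pr => e e0.
have [p [q [cp cq -> lt]]] := dnorm_decomp hX u e0.
rewrite psiB !nPsi// (le_trans (ler_normB _ _))// !normr_id.
exact: ltW.
Qed.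

Lemma functional_cvg (v : nat -> X) x : v @ \oo --> x ->
  (fun n => Psi (v n)) @ \oo --> Psi x.
Proof. by move=> vx; have [_ cPsi _] := hPsi; apply: continuous_cvg => //; exact: cPsi. Qed.

Definition kato_loss (c : R) (u : X) : R :=
  limn (fun n => Psi (iter n (jump c) u)).

Lemma kato_loss_cvg (c : R) u : 0 < c ->
  (fun n => Psi (iter n (jump c) u)) @ \oo --> kato_loss c u.
Proof.
move=> c0.
have pos p : cone p -> cvgn (fun n => Psi (iter n (jump c) p)).
  move=> cp.
  have ci n : cone (iter n (jump c) p).
    exact: substoch_op_pos (substoch_op_iter n (opJ c0)) cp.
  apply: nonincreasing_is_cvgn.
    apply/nonincreasing_seqP => n; rewrite (nPsi (ci n)) (nPsi (ci n.+1)).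
    by have [_ _] := opJ c0; apply; exact: ci.
  by exists 0 => _ [n _ <-]; rewrite nPsi.
have [p [q [cp cq ->]]] := cone_generating hX u.
suff : cvgn (fun n => Psi (iter n (jump c) (p - q))) by [].
have -> : (fun n => Psi (iter n (jump c) (p - q))) =
    (fun n => Psi (iter n (jump c) p) - Psi (iter n (jump c) q)).
  apply/funext => n; have opn := substoch_op_iter n (opJ c0).
  by rewrite (linear_B (substoch_op_lin opn)) psiB.
by apply: is_cvgB; exact: pos.
Qed.

Let real_unique (v : nat -> R) (a b : R) : v @ \oo --> a -> v @ \oo --> b -> a = b.
Proof. by move=> va vb; exact: (cvg_unique (@Rhausdorff R) va vb). Qed.

Lemma kato_lossB (c : R) u v : 0 < c ->
  kato_loss c (u - v) = kato_loss c u - kato_loss c v.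
Proof.
move=> c0; apply: (real_unique (@kato_loss_cvg c (u - v) c0)).
have -> : (fun n => Psi (iter n (jump c) (u - v))) =
    (fun n => Psi (iter n (jump c) u) - Psi (iter n (jump c) v)).
  apply/funext => n; have opn := substoch_op_iter n (opJ c0).
  by rewrite (linear_B (substoch_op_lin opn)) psiB.
by apply: cvgB; exact: kato_loss_cvg.
Qed.

Lemma kato_loss_le (c : R) u : 0 < c -> `|kato_loss c u| <= dnorm u.
Proof.
move=> c0; apply: (@cvgn_dist_le R R^o _ _ _ (@kato_loss_cvg c u c0)).
exists 0%N => n _; rewrite (le_trans (functional_le_dnorm _))//.
exact: substoch_op_dnorm (substoch_op_iter n (opJ c0)).
Qed.

(** With [f = (c - A) x] the argument is [f - J f], and the limit of [Psi (J^n f)] does not change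
    when the index is shifted. *)
Lemma kato_loss_range (c : R) x y : 0 < c -> has_gen U x y ->
  kato_loss c (c *: x - y - B x) = 0.
Proof.
move=> c0 xy; set f := c *: x - y.
have -> : B x = jump c f by rewrite /kato_jump (resolventE hX hU c0 xy).
rewrite kato_lossB//; apply/eqP; rewrite subr_eq0; apply/eqP.
apply: (real_unique (@kato_loss_cvg c f c0)).
have := @kato_loss_cvg c (jump c f) c0.
under eq_fun do rewrite -iterSr.
by rewrite (cvg_shiftS (fun n => Psi (iter n (jump c) f))).
Qed.

Lemma kato_loss0_iter (c : R) u : 0 < c -> (forall v, kato_loss c v = 0) ->
  (fun n => iter n (jump c) u) @ \oo --> (0 : X).
Proof.
move=> c0 l0.
have pos p : cone p -> (fun n => iter n (jump c) p) @ \oo --> (0 : X).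
  move=> cp; apply/cvgn_distP => e e0.
  have := @kato_loss_cvg c p c0; rewrite l0 => /(cvgn_distP (X := R^o)) /(_ e e0)[N NP].
  exists N => n /NP; rewrite !subr0 nPsi ?normr_id//.
  exact: substoch_op_pos (substoch_op_iter n (opJ c0)) cp.
have [p [q [cp cq ->]]] := cone_generating hX u.
have -> : (fun n => iter n (jump c) (p - q)) =
    (fun n => iter n (jump c) p - iter n (jump c) q).
  apply/funext => n; have opn := substoch_op_iter n (opJ c0).
  by rewrite (linear_B (substoch_op_lin opn)).
by rewrite -[X in _ --> X](subrr 0); apply: cvgB; exact: pos.
Qed.

(* With [b_n], [a_n] the approximations for [l], [m] and [g_n = Psi (B b_n - B a_n)],
   the difference of the terms defining the two losses is [g_(n+1) - g_n]; it is
   eventually at most any positive number, while [g_n >= 0]. *)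
Lemma kato_loss_indep_pos (l m : R) u : 0 < m -> m < l -> cone u ->
  kato_loss l (u + (l - m) *: F m u) = kato_loss m u.
Proof.
move=> m0 ml cu; have l0 := lt_trans m0 ml; set y := F m u; set w := u + _.
have lm0 : 0 < l - m by rewrite subr_gt0.
have yE : F l w = y.
  exact: (kato_resolvent_identity_pos hX hPsi hU hBlin hBpos hAB).
have cy : cone y.
  have := kato_approx_le hX hPsi hU hBlin hBpos hAB 0 m0 cu.
  by rewrite (kato_approx0 B hX hU)// subr0.
have cw : cone w by apply: (coneD hX) => //; apply: (coneZ hX) => //; exact: ltW.
pose b n := approx l n w; pose a n := approx m n u.
have ba n : cone (b n - a n).
  exact: (approx_ge hX hPsi hU hBlin hBpos hAB).
have cB n : cone (B (b n) - B (a n)).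
  by apply: (approxB_pos hX hU hBlin hBpos) => //; exact: ba.
have yb n : cone (y - b n).
  by rewrite -yE; exact: (kato_approx_le hX hPsi hU hBlin hBpos hAB).
pose g n := Psi (B (b n) - B (a n)).
have iterE (c : R) v n : 0 < c ->
    iter n.+1 (jump c) v = B (approx c n.+1 v) - B (approx c n v).
  move=> c0; have := kato_sourceS hX hU hBlin c0 n.+1 v => /=.
  rewrite -!/(jump _ _) /kato_jump -!/(approx _ _ _) => e.
  have -> : B (approx c n.+1 v) = (v + B (approx c n.+1 v)) - v by lmod R X.
  by rewrite [X in X - v]e; lmod R X.
have dE n : Psi (iter n.+1 (jump l) w) - Psi (iter n.+1 (jump m) u) = g n.+1 - g n.
  by rewrite !iterE// /g !psiB; ring.
(* [b n.+1 - a n.+1] is [res m] of a sum of two vectors of the cone, so [B] of it is the jump of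
   that sum, with norm at most the sum of the two norms. *)
have gstep n : g n.+1 - g n <= (l - m) * `|y - b n.+1|.
  have e : b n.+1 - a n.+1 = res m ((l - m) *: (y - b n.+1) + (B (b n) - B (a n))).
    rewrite -[LHS]opprB (approx_diff B hX hU)//.
    rewrite -(linear_N (resolvent_linear hX hU m0)); congr (res m _).
    by rewrite /w -/(a n) -/(b n.+1) -/(b n); lmod R X.
  have [_ eB _] := perturbationB hU hBlin hBpos
    (@approx_gen _ _ _ U B hX hU l n.+1 w l0) (@approx_gen _ _ _ U B hX hU m n.+1 u m0).
  have c1 : cone ((l - m) *: (y - b n.+1)) by apply: (coneZ hX) => //; exact: ltW.
  have cs : cone ((l - m) *: (y - b n.+1) + (B (b n) - B (a n))) by apply: (coneD hX).
  rewrite lerBlDr /g -eB -/(a n.+1) -/(b n.+1) e.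
  have [_ pJ nJ] := opJ m0.
  rewrite -/(jump m _) nPsi; last exact: pJ.
  rewrite (le_trans (nJ _ cs))// (cone_normD hX c1 (cB n)).
  by rewrite normrZ gtr0_norm// nPsi.
pose D := kato_loss l w - kato_loss m u.
have Dlim : (fun n => g n.+1 - g n) @ \oo --> D.
  have -> : (fun n => g n.+1 - g n) =
      (fun n => Psi (iter n.+1 (jump l) w) - Psi (iter n.+1 (jump m) u)).
    by apply/funext => n; rewrite dE.
  apply: cvgB.
    rewrite (cvg_shiftS (fun n => Psi (iter n (jump l) w))).
    exact: kato_loss_cvg.
  rewrite (cvg_shiftS (fun n => Psi (iter n (jump m) u))).
  exact: kato_loss_cvg.
have bl : (fun n => b n) @ \oo --> y by rewrite -yE; exact: kcvg.
have D_le0 : D <= 0.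
  apply/ler_addgt0Pr => e e0.
  have [N NP] := (cvgn_distP _ _).1 bl (e / 2 / (l - m)) ltac:(by rewrite !divr_gt0).
  have [N' NP'] := (cvgn_distP (X := R^o) _ _).1 Dlim (e / 2) ltac:(lra).
  have h1 := NP (maxn N N').+1 (leqW (leq_maxl _ _)).
  have := NP' (maxn N N') (leq_maxr _ _); rewrite ler_norml => /andP[h2 _].
  have := gstep (maxn N N'); rewrite distrC in h1.
  have : (l - m) * `|y - b (maxn N N').+1| <= e / 2.
    by rewrite mulrC -ler_pdivlMr.
  move: h2 => /=; lra.
have g0 n : 0 <= g n by rewrite /g nPsi.
(* If [D < 0], then from some [N] on [g] falls by at least [- D / 2] per step and becomes negative
   after [k] steps. *)
have D_ge0 : 0 <= D.
  rewrite leNgt; apply/negP => D0.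
  have [N NP] := (cvgn_distP (X := R^o) _ _).1 Dlim (- D / 2) ltac:(lra).
  have gN k : g (N + k)%N <= g N + k%:R * (D / 2).
    elim: k => [|k IH]; first by rewrite addn0 mul0r addr0.
    rewrite addnS -natr1 mulrDl mul1r.
    have := NP (N + k)%N (leq_addr _ _); rewrite ler_norml => /andP[_ /=].
    lra.
  pose k := (Num.truncn (g N / (- D / 2))).+1.
  have := gN k; have := g0 (N + k)%N.
  have : g N < k%:R * (- D / 2) by rewrite -ltr_pdivrMr ?truncnS_gt//; lra.
  lra.
apply/eqP; rewrite -subr_eq0; apply/eqP.
by apply/eqP; rewrite eq_le D_le0 D_ge0.
Qed.

Lemma kato_loss_indep_lt (l m : R) u : 0 < m -> m < l ->
  kato_loss l (u + (l - m) *: F m u) = kato_loss m u.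
Proof.
move=> m0 ml; have l0 := lt_trans m0 ml.
have [p [q [cp cq ->]]] := cone_generating hX u.
rewrite kato_lossB// -(kato_loss_indep_pos m0 ml cp) -(kato_loss_indep_pos m0 ml cq).
rewrite -kato_lossB//; congr (kato_loss _ _).
rewrite (linear_B (kato_resolvent_linear hX hPsi hU hBlin hBpos hAB m0)).
by lmod R X.
Qed.

Lemma kato_loss_indep (l m : R) u : 0 < l -> 0 < m ->
  kato_loss l (u + (l - m) *: F m u) = kato_loss m u.
Proof.
move=> l0 m0; have [ml|lm|->] := ltgtP m l; first exact: kato_loss_indep_lt.
  (* The proved case runs from [l] up to [m]; by the resolvent identity the two corrections
     cancel. *)
  rewrite -(kato_loss_indep_lt (u + (l - m) *: F m u) l0 lm).
  rewrite (kato_resolvent_identity hX hPsi hU hBlin hBpos hAB)//.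
  by congr (kato_loss _ _); lmod R X.
by rewrite subrr scale0r addr0.
Qed.

(** With [j = J^n u], the term of rank [n] is [Psi j - c Psi (R j) - Psi (J j)]: the outer terms
    telescope and the middle ones add up to [c Psi (v_n)]. *)
Lemma abar_series (c : R) u : 0 < c ->
  series (abar_term Psi (generator U) B c u) @ \oo -->
    Psi u - c * Psi (F c u) - kato_loss c u.
Proof.
move=> c0.
have E : series (abar_term Psi (generator U) B c u) =
    fun n => Psi u - c * Psi (approx c n u) - Psi (iter n (jump c) u).
  apply/funext; elim => [|n IH].
    rewrite /series /= big_geq// (kato_approx0 B hX hU)//.
    by have := psiZ 0 0; rewrite scale0r mul0r => ->; ring.
  rewrite seriesSr IH /abar_term /a_fun -/(iter n (jump c) u).
  set j := iter n (jump c) u.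
  have [_ ->] := has_gen_dom (@has_gen_resolvent _ _ _ hX _ hU c j c0).
  rewrite (kato_approx_step hX hU hBlin c0) -/j -/(jump c j).
  by rewrite !(psiB, psiD, psiZ) /=; ring.
rewrite E; apply: cvgB; last exact: kato_loss_cvg.
apply: cvgB; first exact: cvg_cst.
by apply: cvgMr; apply: functional_cvg; exact: kcvg.
Qed.

End Loss.

(** * Identification of the minimal semigroup *)

Section Minimal.
Context {R : realType} {X : completeNormedModType R}.
Variables (cone : set X) (Psi : X -> R) (U V : R -> X -> X) (B : X -> X).
Hypothesis hX : abstract_state_space cone.
Hypothesis hPsi : norm_functional cone Psi.
Hypothesis hU : substochastic cone U.
Hypothesis hBlin : linear_on (dom (generator U)) B.
Hypothesis hBpos : positive_on cone (dom (generator U)) B.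
Hypothesis hAB : forall u, dom (generator U) u -> cone u ->
  Psi (generator U u + B u) <= 0.
Hypothesis hV : minimal_semigroup cone (perturbed (generator U) B) V.
Local Notation approx := (kato_approx U B).
Local Notation F := (kato_resolvent U B).
Local Notation jump := (kato_jump U B).
Local Notation loss := (kato_loss Psi U B).

Let hVs : substochastic cone V := hV.1.1.

Let kcvg (c : R) u : 0 < c -> (fun n => approx c n u) @ \oo --> F c u.
Proof. by move=> c0; apply: (kato_cvg hX hPsi hU hBlin hBpos hAB). Qed.

Lemma perturbed_extension x y : has_gen U x y -> has_gen V x (y + B x).
Proof.
move=> xy; apply/graph_generatorP; apply: hV.1.2.
by have [dx <-] := has_gen_dom xy; split.
Qed.

Lemma kato_semigroup_exists : exists2 W,
  substochastic_extension cone (perturbed (generator U) B) W &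
  forall (c : R) u, 0 < c -> has_gen W (F c u) (c *: F c u - u).
Proof.
have Fop := kato_resolvent_op hX hPsi hU hBlin hBpos hAB.
have Fid := kato_resolvent_identity hX hPsi hU hBlin hBpos hAB.
have Fap u (e : R) : 0 < e -> exists2 c, 0 < c & dnorm cone (c *: F c u - u) <= e.
  move=> e0; have [L L0 LP] := kato_resolvent_approx hX hPsi hU hBlin hBpos hAB u e0.
  by exists L => //; exact: LP.
have gW := euler_semigroup_resolvent hX Fop Fid Fap.
exists (euler_semigroup F) => //; split.
  exact: (euler_semigroup_substochastic hX Fop Fid Fap).
move=> [x _] [/= dx ->].
have xy : has_gen U x (generator U x) by apply/graph_generatorP; split.
apply/graph_generatorP.
(* Every [x] in the domain of [A] lies in the range of [F 1], where the generator of the new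
   semigroup is known. *)
have FE := kato_resolvent_perturbed hX hPsi hU hBlin hBpos hAB ltr01 xy.
have := gW 1 (1 *: x - generator U x - B x) ltr01; rewrite FE.
suff -> : 1 *: x - (1 *: x - generator U x - B x) = generator U x + B x by [].
by lmod R X.
Qed.

Lemma resolvent_minimal (c : R) u : 0 < c -> resolvent (generator V) c u = F c u.
Proof.
move=> c0.
have lV := resolvent_linear hX hVs c0.
have lF := kato_resolvent_linear hX hPsi hU hBlin hBpos hAB c0.
have pos p : cone p -> resolvent (generator V) c p = F c p.
  move=> cp; set x := resolvent _ _ _; apply: (cone_antisym hX).
    have [W [hW extW] gW] := kato_semigroup_exists.
    have xg : has_gen (damped c V) x (- p).
      apply/has_gen_dampedE; rewrite addrC.
      exact: (has_gen_resolvent hX hVs c0).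
    have yg : has_gen (damped c W) (F c p) (- p).
      by apply/has_gen_dampedE; rewrite addrC; exact: gW.
    have le t w : 0 <= t -> cone w -> cone (damped c W t w - damped c V t w).
      move=> t0 cw; rewrite /damped -scalerBr; apply: (coneZ hX); first exact: expR_ge0.
      by apply: hV.2.
    (* The resolvent integrals over [[0, n]] are ordered because [V] lies below [W]; the damped
       remainders vanish as [n] grows. *)
    have lim : (fun n => (F c p - damped c W n%:R (F c p)) -
        (x - damped c V n%:R x)) @ \oo --> (F c p - 0) - (x - 0).
      by apply: cvgB; apply: cvgB; (exact: cvg_cst || exact: (damped_cvg0 hX)).
    rewrite !subr0 in lim; apply: (cone_lim hX _ lim) => n.
    apply: (generator_le hX _ _ le cp xg yg) => //.
      exact: (substochastic_damped hX (ltW c0) hVs).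
    exact: (substochastic_damped hX (ltW c0) hW).
  have lim : (fun n => x - approx c n p) @ \oo --> x - F c p.
    by apply: cvgB; [exact: cvg_cst|exact: kcvg].
  apply: (cone_lim hX _ lim) => n.
  (* The generator of [V] extends [A + B], so [c - G] sends [v_n] to [p - J^n p]; thus [x - v_n] is
     the resolvent of [V] at [J^n p], a vector of the cone. *)
  have [g e] := kato_approx_perturbed hX hU hBlin c0 n p.
  have gV := perturbed_extension g; rewrite e in gV.
  have := resolventE hX hVs c0 gV.
  have -> : c *: approx c n p - (c *: approx c n p - p + iter n (jump c) p) =
      p - iter n (jump c) p by lmod R X.
  rewrite (linear_B lV) -/x => <-.
  have -> : x - (x - resolvent (generator V) c (iter n (jump c) p)) =
      resolvent (generator V) c (iter n (jump c) p) by lmod R X.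
  apply: (res_pos hX hVs c0).
  exact: (iter_jump_pos hX hPsi hU hBlin hBpos hAB c0).
have [p [q [cp cq ->]]] := cone_generating hX u.
by rewrite (linear_B lV) (linear_B lF) !pos.
Qed.

Lemma minimal_gen (c : R) u : 0 < c -> has_gen V (F c u) (c *: F c u - u).
Proof.
by move=> c0; rewrite -(resolvent_minimal u c0); exact: (has_gen_resolvent hX hVs c0).
Qed.

Lemma minimal_resolventE (c : R) x y : 0 < c -> has_gen V x y -> F c (c *: x - y) = x.
Proof.
by move=> c0 xy; rewrite -(resolvent_minimal _ c0); exact: (resolventE hX hVs c0 xy).
Qed.

(** For [v = F c u] the value [a0 v] is [Psi u - c Psi v], and the series for [abar v] sums to the
    same quantity minus the loss. *)
Lemma Xi_loss (c : R) u : 0 < c ->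
  Xi Psi (generator U) B (generator V) c u = loss c u.
Proof.
move=> c0; rewrite /Xi (resolvent_minimal u c0).
have psiB := functional_B hPsi; have psiZ := functional_Z hPsi.
have psiD := functional_D hPsi.
set v := F c u; have gv : has_gen V v (c *: v - u) := @minimal_gen c u c0.
pose S := [set r : R | forall l w, 0 < l -> resolvent (generator V) l w = v ->
  series (abar_term Psi (generator U) B l w) @ \oo --> r].
(* [abar_fun] asks for one sum common to all pairs [(l, w)] with resolvent value [v]. These have
   [w = u + (l - c) v], and the losses agree by [kato_loss_indep]; without such a common value
   [xget] would return its default 0. *)
have Sr : S (Psi u - c * Psi v - loss c u).
  move=> l w l0; rewrite (resolvent_minimal w l0) => wv.
  have gv' : has_gen V v (l *: v - w) by rewrite -wv; exact: minimal_gen.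
  have wE : w = u + (l - c) *: v.
    have := has_gen_unique gv gv' => e.
    have -> : w = l *: v - (l *: v - w) by lmod R X.
    by rewrite -e; lmod R X.
  have := @abar_series _ _ _ _ _ _ hX hPsi hU hBlin hBpos hAB l w l0.
  rewrite wv {2 3}wE (kato_loss_indep hX hPsi hU hBlin hBpos hAB u l0 c0).
  rewrite psiD psiZ.
  by have -> : Psi u + (l - c) * Psi v - l * Psi v = Psi u - c * Psi v by ring.
have abarE : abar_fun Psi (generator U) B (generator V) v =
    Psi u - c * Psi v - loss c u.
  rewrite /abar_fun; have := @xgetPex _ 0 S (ex_intro _ _ Sr).
  move=> /(_ c u c0 (resolvent_minimal u c0)) lim1.
  exact: (cvg_unique (@Rhausdorff R) lim1 (Sr c u c0 (resolvent_minimal u c0))).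
rewrite abarE /a0_fun; have [_ ->] := has_gen_dom gv.
rewrite psiB psiZ; ring.
Qed.

Lemma closure_pairP (A : set (X * X)) x y : closure A (x, y) <->
  forall e : R, 0 < e ->
    exists x' y', [/\ A (x', y'), `|x - x'| <= e & `|y - y'| <= e].
Proof.
split=> [cl e e0|cl N].
  have [[x' y'] [Axy [/= bx b_y]]] := cl _ (nbhsx_ballx (x, y) _ e0).
  exists x', y'; split=> //; move: bx b_y; rewrite -!ball_normE => b1 b2; exact: ltW.
move=> /nbhs_ballP[e /= e0 eN].
have [x' [y' [Axy xe ye]]] := cl (e / 2) ltac:(lra).
exists (x', y'); split=> //; apply: eN; split; rewrite -ball_normE /=; lra.
Qed.

(** Closedness of the generator: the relation [F 1 (x' - y') = x'] on its graph survives limits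
    because [F 1] is bounded. *)
Lemma minimal_closure_sub :
  closure (graph (perturbed (generator U) B)) `<=` graph (generator V).
Proof.
move=> [x y] /closure_pairP cl; apply/graph_generatorP.
have [M M0 dM] := dnorm_equiv hX.
have opF := kato_resolvent_op hX hPsi hU hBlin hBpos hAB ltr01.
have lF := substoch_op_lin opF.
have xE : F 1 (x - y) = x.
  rewrite -[F _ _]scale1r; apply/eqP; rewrite -subr_eq0 -normr_le0.
  apply/ler_addgt0Pr => e e0; rewrite add0r.
  (* With both coordinates within [d], the term through [F 1] costs at most [2 M d] and the other
     one [d]. *)
  have M1 : 0 < 2 * M + 1 by lra.
  have [x' [y' [g xx yy]]] := cl (e / (2 * M + 1)) (divr_gt0 e0 M1).
  have gV : has_gen V x' y' by apply/graph_generatorP; exact: hV.1.2.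
  have FE : 1 *: F 1 (x' - y') = x'.
    by rewrite scale1r -{1}[x']scale1r (minimal_resolventE ltr01 gV).
  have -> : 1 *: F 1 (x - y) - x = 1 *: F 1 ((x - x') - (y - y')) - (x - x').
    have -> : (x - x') - (y - y') = (x - y) - (x' - y') by lmod R X.
    by rewrite (linear_B lF (x - y) (x' - y')) /= FE opprB addrA subrK.
  rewrite (le_trans (ler_normB _ _))//.
  have h1 := le_trans (norm_le_dnorm hX _)
    (substoch_op_dnorm hX ((x - x') - (y - y')) opF).
  have h2 := dM (x - x' - (y - y')).
  have h3 : M * `|x - x' - (y - y')| <=
      M * (e / (2 * M + 1) + e / (2 * M + 1)).
    by rewrite ler_pM2l// (le_trans (ler_normB _ _))// lerD.
  have h4 : M * (e / (2 * M + 1) + e / (2 * M + 1)) + e / (2 * M + 1) = e.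
    by field; rewrite gt_eqF.
  lra.
have := @minimal_gen 1 (x - y) ltr01; rewrite xE.
by have -> : 1 *: x - (x - y) = y by lmod R X.
Qed.

Lemma closure_of_loss0 (c : R) : 0 < c -> (forall u, loss c u = 0) ->
  graph (generator V) = closure (graph (perturbed (generator U) B)).
Proof.
move=> c0 l0; apply/seteqP; split; last exact: minimal_closure_sub.
move=> [x y] /graph_generatorP xy; apply/closure_pairP => e e0.
set u := c *: x - y; have xE : F c u = x := minimal_resolventE c0 xy.
have lim1 : (fun n => approx c n u) @ \oo --> x by rewrite -xE; exact: kcvg.
have it0 := kato_loss0_iter hX hPsi hU hBlin hBpos hAB u c0 l0.
have lim2 : (fun n => c *: approx c n u - u + iter n (jump c) u) @ \oo --> y.
  have -> : y = c *: x - u + 0 by rewrite /u; lmod R X.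
  by apply: cvgD => //; apply: cvgB; [exact: cvgZr|exact: cvg_cst].
have [N1 N1P] := (cvgn_distP _ _).1 lim1 e e0.
have [N2 N2P] := (cvgn_distP _ _).1 lim2 e e0.
pose n := maxn N1 N2.
have [g ge] := kato_approx_perturbed hX hU hBlin c0 n u.
have [dg gE] := has_gen_dom g.
exists (approx c n u), (c *: approx c n u - u + iter n (jump c) u); split.
- by split; [exact: dg|rewrite -ge -gE].
- by rewrite distrC N1P// leq_maxl.
- by rewrite distrC N2P// leq_maxr.
Qed.

Lemma loss0_of_closure (c : R) u : 0 < c ->
  graph (generator V) = closure (graph (perturbed (generator U) B)) ->
  loss c u = 0.
Proof.
move=> c0 gE; have [M M0 dM] := dnorm_equiv hX.
have : closure (graph (perturbed (generator U) B)) (F c u, c *: F c u - u).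
  by rewrite -gE; apply/graph_generatorP; exact: minimal_gen.
move=> /closure_pairP cl.
apply/eqP; rewrite -normr_le0; apply/ler_addgt0Pr => e e0; rewrite add0r.
(* If both coordinates are within [d], then [u'] is within [(c + 1) d] of [u] in norm, hence within
   [M (c + 1) d] in [dnorm], which bounds the loss. *)
have M1 : 0 < M * (c + 1) by rewrite mulr_gt0//; lra.
have [x' [y' [[/= dx ->] xx yy]]] := cl (e / (M * (c + 1))) (divr_gt0 e0 M1).
set u' := c *: x' - generator U x' - B x'.
have u'0 : loss c u' = 0.
  apply: (kato_loss_range hX hPsi hU hBlin hBpos hAB c0).
  by apply/graph_generatorP; split.
have -> : loss c u = loss c (u - u').
  by rewrite (kato_lossB hX hPsi hU hBlin hBpos hAB)// u'0 subr0.
rewrite (le_trans (kato_loss_le hX hPsi hU hBlin hBpos hAB _ c0))//.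
rewrite (le_trans (dM _))//.
have -> : u - u' = c *: (F c u - x') -
    (c *: F c u - u - (generator U x' + B x')) by rewrite /u'; lmod R X.
have h1 := ler_normB (c *: (F c u - x')) (c *: F c u - u - (generator U x' + B x')).
rewrite normrZ gtr0_norm// in h1.
have h2 : c * `|F c u - x'| <= c * (e / (M * (c + 1))) by rewrite ler_pM2l.
have h3 : M * (c * (e / (M * (c + 1))) + e / (M * (c + 1))) = e.
  by field; rewrite !gt_eqF//; lra.
rewrite -h3 ler_pM2l//; move: yy => /=; lra.
Qed.

End Minimal.

Theorem corollary3p6 (R : realType) (X : completeNormedModType R)
    (cone : set X) (Psi : X -> R) (U V : R -> X -> X) (B : X -> X)
    (hX : abstract_state_space cone)
    (hPsi : norm_functional cone Psi)
    (hU : substochastic cone U)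
    (hBlin : linear_on (dom (generator U)) B)
    (hBpos : positive_on cone (dom (generator U)) B)
    (hAB : forall u, dom (generator U) u -> cone u ->
       Psi (generator U u + B u) <= 0)
    (hV : minimal_semigroup cone (perturbed (generator U) B) V) :
  (graph (generator V) = closure (graph (perturbed (generator U) B)) <->
     exists2 lambda : R, 0 < lambda &
       forall u, Xi Psi (generator U) B (generator V) lambda u = 0) /\
  (graph (generator V) = closure (graph (perturbed (generator U) B)) <->
     forall lambda : R, 0 < lambda ->
       forall u, Xi Psi (generator U) B (generator V) lambda u = 0).
Proof.
have XiE := Xi_loss hX hPsi hU hBlin hBpos hAB hV.
have loss0 := loss0_of_closure hX hPsi hU hBlin hBpos hAB hV.
have clos := closure_of_loss0 hX hPsi hU hBlin hBpos hAB hV.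
split; split.
- by move=> gE; exists 1 => // u; rewrite XiE//; exact: loss0.
- by move=> [l l0 X0]; apply: (clos l l0) => u; rewrite -XiE.
- by move=> gE l l0 u; rewrite XiE//; exact: loss0.
- by move=> X0; apply: (clos 1 ltr01) => u; rewrite -XiE//; exact: X0.
Qed.
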